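(* Let $D$ and $M$ be positive integers, let $\gamma\in(0,1)$, and set $d=\max(2,DM-1)$. Let $\mathbb{K}\subset\mathbb{C}$ be a number field of degree $D$ over $\mathbb{Q}$. For every $j=1,\dots,M$ let $\{S_{n,j}\}_{n=1}^\infty$ be a sequence of integers, let $\{b_{n,j}\}_{n=1}^\infty$, $\{c_{n,j}\}_{n=1}^\infty$, $\{d_{n,j}\}_{n=1}^\infty$ be sequences of algebraic integers in $\mathbb{K}$ with $d_{n,j}\neq 0$, let $a_{0,j}\in\mathbb{K}$, and let $\{a_{n,j}\}_{n=1}^\infty$ be the sequence of real numbers given by $$a_{n,j}=\frac{S_{n,j}b_{n,j}+c_{n,j}}{d_{n,j}},\qquad\text{with } a_{n,j}\ge 1 .$$ Let $\alpha_j=[a_{0,j};a_{1,j},a_{2,j},\dots]$. Assume that for all $n\ge1$ and all $j=1,\dots,M$ $$a_{n,1}<\max\big(a_{n,M}2^{(\log_2 a_{n,M})^\gamma},\,2^{d^{n\gamma}}\big)$$ and that each of $\overline{|b_{n,j}|}$, $\overline{|c_{n,j}|}$, $\overline{|d_{n,j}|}$, where $\overline{|x|}$ denotes the maximal modulus of the conjugates of $x$, is at most $\max\big(2^{(\log_2 a_{n,j})^\gamma},2^{d^{n\gamma}}\big)$. Assume that $$\liminf_{n\to\infty}\sqrt n\Big(\frac{a_{n,j}}{a_{n,j+1}}-1\Big)>0\qquad\text{for all } j=1,\dots,M-1,$$ and that $$\limsup_{n\to\infty}a_{n,j}^{1/d^n}=\infty\qquad\text{for all } j=1,\dots,M.$$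 Suppose finally that at least one of the following two conditions holds: (i) for all $n\ge1$ and all $j=1,\dots,M$, every conjugate of $1/a_{n,j}$ has modulus at most $\tfrac12$; (ii) for every $j=1,\dots,M$ and every embedding $\sigma$ of $\mathbb{K}$ into $\overline{\mathbb{Q}}\subset\mathbb{C}$ there is $e_{j,\sigma}\in\{0,1\}$, not depending on $n$, such that for all $n\ge1$ $$(-1)^{e_{j,\sigma}}\,\Re(\sigma a_{n,j})\ge \max\big(2^{(\log_2 a_{n,1})^\gamma},2^{d^{n\gamma}}\big)^{-1}.$$ Then the numbers $\alpha_1,\dots,\alpha_M$ and $1$ are linearly independent over $\mathbb{K}$.
   Context: For an algebraic number $x$, the house of $x$ (written in the claim as $\overline{|x|}$) is $\max_{1\le i\le k}|x_i|$, where $x_1=x,x_2,\dots,x_k$ are all the different conjugates of $x$ over $\mathbb{Q}$. $\log_2$ is the logarithm in base $2$. For $x_0$ a complex number and real numbers $x_1,x_2,\dots\ge1$, $[x_0;x_1,x_2,\dots]$ denotes the continued fraction $x_0+\cfrac{1}{x_1+\cfrac{1}{x_2+\cdots}}$, i.e. the limit of the finite continued fractions $[x_0;x_1,\dots,x_n]$; the terms need not be integers. *)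

(* Defs.v *)
From HB Require Import structures.
From mathcomp Require Export all_boot all_order all_algebra all_field.
From mathcomp Require Export all_classical all_reals all_analysis.
From mathcomp Require Export complex.
Set Implicit Arguments.
Unset Strict Implicit.
Unset Printing Implicit Defensive.
Import Order.TTheory GRing.Theory Num.Theory.
Import numFieldNormedType.Exports.
Local Open Scope classical_set_scope.
Local Open Scope ring_scope.

Definition algebraic_integer (K : fieldExtType rat) (x : K) : Prop :=
  integralOver (intr : int -> K) x.

(* The minimal polynomial has its coefficients in the image of rat, so the list
   of its roots depends on the embedding iota only through their order. *)
Definition conjugates (R : realType) (K : fieldExtType rat)
    (iota : {rmorphism K -> R[i]}) (x : K) : seq R[i] :=
  sval (closed_field_poly_normal (map_poly iota (minPoly 1%AS x))).

Lemma mem_conjugates (R : realType) (K : fieldExtType rat)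
    (iota : {rmorphism K -> R[i]}) (x : K) (z : R[i]) :
  (z \in conjugates iota x) = root (map_poly iota (minPoly 1%AS x)) z.
Proof.
rewrite /conjugates; case: closed_field_poly_normal => r /=.
rewrite (monicP (monic_map iota (monic_minPoly _ _))) scale1r => ->.
by rewrite root_prod_XsubC.
Qed.

(* [Num.max] is started at 0, which is harmless since moduli are nonnegative
   and the list of conjugates is never empty. *)
Definition house (R : realType) (K : fieldExtType rat)
    (iota : {rmorphism K -> R[i]}) (x : K) : R :=
  \big[Num.max/0]_(z <- conjugates iota x) ComplexField.Normc.normc z.

Definition log2 (R : realType) (x : R) : R := ln x / ln 2.

(* max(2^((log_2 x)^gamma), 2^(d^(n gamma))) *)
Definition growth_bound (R : realType) (gamma : R) (d n : nat) (x : R) : R :=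
  Num.max (2 `^ (log2 x `^ gamma)) (2 `^ (d%:R `^ (n%:R * gamma))).

(* [x 0; x 1, ..., x n] *)
Fixpoint convergent (F : fieldType) (x : nat -> F) (n : nat) : F :=
  if n is m.+1 then x 0%N + (convergent (fun k => x k.+1) m)^-1 else x 0%N.

(* R[i] carries no topology of its own; R[i]^o has that of the modulus. *)
Definition continued_fraction (R : realType) (x : nat -> R[i]) : R[i] :=
  limn (convergent x : nat -> R[i]^o).

(* Main.v *)
From HB Require Import structures.
From mathcomp Require Import ring lra zify.
Require Import Defs.
Set Implicit Arguments.
Unset Strict Implicit.
Unset Printing Implicit Defensive.
Import Order.TTheory GRing.Theory Num.Theory.
Import numFieldNormedType.Exports.
Local Open Scope classical_set_scope.
Local Open Scope ring_scope.
Import ComplexField.Normc.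

(** The proof is the Liouville argument: a nonzero linear form with coefficients
    in K in the n-th convergents cannot be too small, because its norm is a
    nonzero rational number of controlled denominator, whereas a linear relation
    between the continued fractions makes it far too small for suitable n.

    Let q_j(n) be the denominator of the n-th convergent p_j(n)/q_j(n) of the
    j-th continued fraction, and suppose
    l_0 + l_1 alpha_1 + ... + l_M alpha_M = 0. After clearing denominators the
    l_j are algebraic integers, and a_{0,j} may be absorbed into l_0. Put
    X(n) = l_0 + sum_j l_j p_j(n)/q_j(n), an element of K.

    X(n) is nonzero for all large n. By the relation it is minus the sum over j
    of l_j (alpha_j - p_j(n)/q_j(n)), and the error of the j-th convergent is
    1/(q_j(n) q_j(n+1)) up to a factor 2 ([convergent_error_bounds]). The liminf
    hypothesis makes a_{n,j} exceed a_{n,k} by a factor 1 + 8/n when j < k and n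
    is large ([column_ratio]); this accumulates in the recurrence for the
    denominators, so that q_j(n)/q_k(n) tends to infinity
    ([denominator_ratio_large]). The errors are thus of different orders of
    magnitude and the last j with l_j nonzero dominates
    ([dominant_term_nonzero]).

    X(n) is not too small. Write u_n for log_2 (max_j a_{n,j}) and h_n for
    u_n^gamma + d^(n gamma). For every embedding s of K, |s(a_{n,j})| is at most
    a_{n,j} times a fixed power of 2^(h_n): the integer S_{n,j} is bounded
    through the real value of a_{n,j}, and the nonzero ones among b_{n,j} and
    e_{n,j} are bounded below at each embedding because their norms are at least
    1 in modulus ([embedding_quotient_bound]). Multiplying X(n) by the
    denominators q_j(n) and by the e_{i,j} with i <= n gives an algebraic integer whose conjugates are at most
    2^(M (u_1 + ... + u_n) + O(h_1 + ... + h_n)); since the norm is at least 1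
    ([linear_form_liouville]) and |X(n)| is at most
    2^(- 2 (u_1 + ... + u_n) - u_{n+1} + O(h_1 + ... + h_{n+1})), one gets
    u_{n+1} <= (D M - 2) (u_1 + ... + u_n) + O(h_1 + ... + h_{n+1}).

    Here D M - 2 <= d - 1. If u_{n+1} <= (d - 1) (u_1 + ... + u_n) held exactly
    for large n, then (u_1 + ... + u_n)/d^n would not increase; the terms h_i
    are too small to change that this quotient stays bounded. The limsup
    hypothesis says that u_n/d^n is unbounded, a contradiction
    ([growth_excess]). *)

(** * Embeddings of a number field and algebraic integers *)

(** Elements of E(y) are polynomials in y modulo the minimal polynomial, so an
    embedding of E extends by sending y to any root of the transported minimal
    polynomial. Composing with [vsproj E] turns an embedding of the subfield into
    a function on all of L, to which [map_poly] applies. *)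
Lemma extend_embedding_root (L : fieldExtType rat) (C : fieldType)
    (E : {subfield L}) (f : {rmorphism subvs_of E -> C}) (y : L) (z : C) :
  root (map_poly (f \o vsproj E) (minPoly E y)) z ->
  exists2 g : {rmorphism subvs_of <<E; y>>%VS -> C},
    (forall u, u \in E -> g (vsproj _ u) = f (vsproj E u)) &
    g (vsproj _ y) = z.
Proof.
move=> rootz.
pose fE p := map_poly (f \o vsproj E) p.
have fEv (p : {poly subvs_of E}) : fE (map_poly vsval p) = map_poly f p.
  by apply/polyP=> i; rewrite !coef_map /= vsvalK.
pose g (v : subvs_of <<E; y>>%VS) : C := (fE (Fadjoin_poly E y (vsval v))).[z].
have gE (v : subvs_of <<E; y>>%VS) p :
    vsval v = (map_poly vsval p).[y] -> g v = (map_poly f p).[z].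
  move=> Dv; rewrite /g Dv Fadjoin_poly_mod; last first.
    by apply/polyOverP=> i; rewrite coef_map subvsP.
  have [m Dm] := polyOver_subvs (minPolyOver E y).
  rewrite Dm -map_modp fEv map_modp.
  rewrite {2}(divp_eq (map_poly f p) (map_poly f m)).
  move: rootz; rewrite Dm [map_poly _ _]fEv => /rootP rootz.
  by rewrite !hornerE rootz mulr0 add0r.
have gP (v : subvs_of <<E; y>>%VS) : exists p : {poly subvs_of E}, vsval v = (map_poly vsval p).[y].
  have /Fadjoin_polyP[p Ep Dp] := subvsP v.
  by have [q Dq] := polyOver_subvs Ep; exists q; rewrite -Dq.
have g_zmod : zmod_morphism g.
  move=> u v; have [[p Dp] [q Dq]] := (gP u, gP v).
  rewrite (gE u p) // (gE v q) // (gE _ (p - q)) ?rmorphB ?hornerE //.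
  by rewrite /= Dp Dq.
have g_mon : monoid_morphism g.
  split; first by rewrite (gE 1 1) ?rmorph1 ?hornerC.
  move=> u v; have [[p Dp] [q Dq]] := (gP u, gP v).
  rewrite (gE u p) // (gE v q) // (gE _ (p * q)) ?rmorphM ?hornerE //.
  by rewrite /= Dp Dq.
pose gM := GRing.isMonoidMorphism.Build _ _ g g_mon.
pose gA := GRing.isZmodMorphism.Build _ _ g g_zmod.
pose G : {rmorphism subvs_of <<E; y>>%VS -> C} := HB.pack g gA gM.
exists G => [u Eu|] /=.
  have Eyu : u \in <<E; y>>%VS by apply: subvP_adjoin.
  by rewrite (gE _ (vsproj E u)%:P) ?map_polyC ?hornerC //= !vsprojK ?memvf.
by rewrite (gE _ 'X) ?map_polyX ?hornerX //= vsprojK ?memv_adjoin.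
Qed.

(** F is a variable rather than the adjunction itself, so that F can later be the
    full field without transport along an equality of subspaces. *)
Lemma extend_embedding_seq (L : fieldExtType rat) (C : closedFieldType)
    (s : seq L) (E F : {subfield L}) (f : {rmorphism subvs_of E -> C}) :
  F = <<E & s>>%VS :> {vspace L} ->
  exists g : {rmorphism subvs_of F -> C},
    forall u, u \in E -> g (vsproj F u) = f (vsproj E u).
Proof.
elim: s E f => [|y s IHs] E f.
  rewrite adjoin_nil subfield_closed => /val_inj eqFE.
  by subst F; exists f.
have /closed_rootP[z rootz] : size (map_poly (f \o vsproj E) (minPoly E y)) != 1.
  have [m Dm] := polyOver_subvs (minPolyOver E y).
  have -> : map_poly (f \o vsproj E) (minPoly E y) = map_poly f m.
    by apply/polyP=> i; rewrite Dm !coef_map /= vsvalK.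
  by rewrite size_map_poly -(size_map_poly vsval) -Dm size_minPoly.
have [g gE _] := extend_embedding_root rootz.
rewrite adjoin_cons => DF; have [h hE] := IHs _ g DF.
by exists h => u Eu; rewrite hE ?gE ?subvP_adjoin.
Qed.

Lemma rmorphism_alg_rat (L : fieldExtType rat) (C : numFieldType)
  (s t : {rmorphism L -> C}) (a : rat) : s a%:A = t a%:A.
Proof.
exact: etrans (fmorph_eq_rat (s \o in_alg L) a)
  (esym (fmorph_eq_rat (t \o in_alg L) a)).
Qed.

(** The minimal polynomial over the prime field has rational coefficients, on
    which all embeddings agree. *)
Lemma map_minPoly_rat (L : fieldExtType rat) (C : numFieldType)
    (s t : {rmorphism L -> C}) (x : L) :
  map_poly s (minPoly 1%AS x) = map_poly t (minPoly 1%AS x).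
Proof.
have /polyOver1P[p ->] := minPolyOver 1%AS x.
rewrite -!map_poly_comp; apply: eq_map_poly => a /=.
exact: rmorphism_alg_rat.
Qed.

(** The conjugates of x are its images under the embeddings of K: send x to the
    given root on the subfield generated by x, then extend to K. This is what
    lets a bound on all embeddings of x bound the norm of x. *)
Lemma exists_embedding_conjugate (R : realType) (K : fieldExtType rat)
    (iota : {rmorphism K -> R[i]}) (x : K) (z : R[i]) :
  z \in conjugates iota x ->
  exists s : {rmorphism K -> R[i]}, s x = z.
Proof.
rewrite mem_conjugates => rootz.
pose f : {rmorphism subvs_of (1%AS : {subfield K}) -> R[i]} := iota \o vsval.
have rootz' : root (map_poly (f \o vsproj 1%AS) (minPoly 1%AS x)) z.
  have [m Dm] := polyOver_subvs (minPolyOver 1%AS x).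
  move: rootz; rewrite Dm -!map_poly_comp.
  by congr is_true; congr root; apply: eq_map_poly => u /=; rewrite vsvalK.
have [g _ gx] := extend_embedding_root rootz'.
have full : {:K}%AS = <<<<1; x>>%AS & vbasis {:K}>>%VS :> {vspace K}.
  apply/esym/eqP; rewrite eqEsubv subvf /=.
  rewrite -{1}(span_basis (vbasisP {:K})).
  apply/span_subvP => u uK; exact: seqv_sub_adjoin.
have [h hE] := extend_embedding_seq g full.
pose hK (u : K) : R[i] := h (vsproj {:K}%AS u).
have hK_zmod : zmod_morphism hK by move=> u v; rewrite /hK linearB rmorphB.
have hK_mon : monoid_morphism hK.
  split=> [|u v]; rewrite /hK.
    rewrite -(rmorph1 h); congr (h _); apply: val_inj.
    by rewrite /= vsprojK ?memvf ?(unitr_algid1 (memvf 1)) ?unitr1.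
  apply: etrans (rmorphM h _ _); congr (h _); apply: val_inj.
  by rewrite /= !vsprojK ?memvf.
pose hM := GRing.isMonoidMorphism.Build _ _ hK hK_mon.
pose hA := GRing.isZmodMorphism.Build _ _ hK hK_zmod.
pose H : {rmorphism K -> R[i]} := HB.pack hK hA hM.
by exists H; rewrite /= /hK hE ?memv_adjoin.
Qed.

Lemma embedding_conjugate (R : realType) (K : fieldExtType rat)
    (iota s : {rmorphism K -> R[i]}) (x : K) : s x \in conjugates iota x.
Proof.
rewrite mem_conjugates (map_minPoly_rat iota s).
by rewrite rmorph_root ?root_minPoly.
Qed.

Lemma normc_ge0 (R : realType) (z : R[i]) : 0 <= normc z.
Proof. by case: z => x y; apply: sqrtr_ge0. Qed.

Lemma normc_real (R : realType) (x : R) : normc x%:C%C = `|x|.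
Proof. by rewrite /= expr0n addr0 sqrtr_sqr. Qed.

Lemma normc_embedding_le_house (R : realType) (K : fieldExtType rat)
    (iota s : {rmorphism K -> R[i]}) (x : K) : normc (s x) <= house iota x.
Proof.
rewrite /house; apply: (le_bigmax_seq 0 (s x)) => //.
exact: embedding_conjugate.
Qed.

Lemma normc_prod (R : realType) (I : Type) (r : seq I) (P : pred I)
    (F : I -> R[i]) :
  normc (\prod_(i <- r | P i) F i) = \prod_(i <- r | P i) normc (F i).
Proof. by apply: (big_morph _ (@normcM R)); apply: normc1. Qed.

(** By Gauss's lemma a rational factor of a monic integral polynomial is, once
    monic, integral. The constant coefficient is nonzero since otherwise X would
    divide the irreducible minimal polynomial. *)
Lemma minPoly_algebraic_integer_coef0 (K : fieldExtType rat) (x : K) :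
  algebraic_integer x -> x != 0 ->
  exists2 k : int, k != 0 & (minPoly 1%AS x)`_0 = k%:~R.
Proof.
move=> [P monP rootP] x0.
have /polyOver1P[m Dm] := minPolyOver 1%AS x.
have mon_m : m \is monic.
  have := monic_minPoly 1%AS x; rewrite Dm !monicE lead_coef_map.
  by rewrite fmorph_eq1.
have PZQ : map_poly (in_alg K) (map_poly intr P) = map_poly intr P.
  by rewrite -map_poly_comp; apply: eq_map_poly => a /=; rewrite scaler_int.
have dvd_m : m %| map_poly intr P.
  rewrite -(dvdp_map (in_alg K)) -Dm PZQ; apply: minPoly_dvdp => //.
  by rewrite -PZQ; apply/polyOver1P; exists (map_poly intr P).
have [p [a a0 Da] [r Dr]] := dvdpP_rat_int dvd_m.
have lp : lead_coef p * lead_coef r = 1.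
  by rewrite -lead_coefM -Dr (monicP monP).
have alp : a * (lead_coef p)%:~R = 1.
  move/monicP: mon_m; rewrite Da lead_coefZ lead_coef_map_inj //.
  exact: intr_inj.
have Dall : a = (lead_coef r)%:~R.
  have lpQ : (lead_coef p)%:~R * (lead_coef r)%:~R = 1 :> rat.
    by rewrite -intrM lp.
  by rewrite -[LHS]mulr1 -[X in _ * X]lpQ mulrA alp mul1r.
exists (lead_coef r * p`_0); last first.
  by rewrite Dm Da coef_map coefZ coef_map /= Dall -intrM scaler_int.
apply: contraNneq x0 => rp0.
have X_dvd : 'X %| minPoly 1%AS x.
  rewrite -['X]subr0 -polyC0 dvdp_XsubCl rootE horner_coef0.
  by rewrite Dm Da coef_map coefZ coef_map /= Dall -intrM rp0 scale0r.
have /orP[eqX|eq1] := minPoly_irr (polyOverX _) X_dvd.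
  by have := root_minPoly 1%AS x; rewrite -(eqp_root eqX) rootX.
by move: eq1; rewrite -size_poly_eq1 size_polyX.
Qed.

(** Liouville's inequality. The product of the conjugates of x is, up to sign, the
    constant coefficient of the minimal polynomial, a nonzero integer. One of the
    conjugates is [iota x]; there are at most dim K - 1 others, each at most B. *)
Lemma algebraic_integer_norm_ge1 (R : realType) (K : fieldExtType rat)
    (iota : {rmorphism K -> R[i]}) (x : K) (B : R) :
  algebraic_integer x -> x != 0 -> 1 <= B ->
  (forall s : {rmorphism K -> R[i]}, normc (s x) <= B) ->
  1 <= normc (iota x) * B ^+ (\dim {:K}).-1.
Proof.
move=> intx x0 B1 xB.
have B0 : 0 <= B by apply: le_trans B1.
have [k k0 Dk] := minPoly_algebraic_integer_coef0 intx x0.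
have conjB z : z \in conjugates iota x -> normc z <= B.
  by case/exists_embedding_conjugate => s <-.
have xr := embedding_conjugate iota iota x.
have Dp : map_poly iota (minPoly 1%AS x) =
    \prod_(z <- conjugates iota x) ('X - z%:P).
  rewrite /conjugates; case: closed_field_poly_normal => r /= {1}->.
  by rewrite (monicP (monic_map iota (monic_minPoly _ _))) scale1r.
have szr : (size (conjugates iota x) <= \dim {:K})%N.
  have := size_prod_XsubC (conjugates iota x) id.
  rewrite -Dp size_map_poly size_minPoly => -[<-].
  by rewrite adjoin_degreeE dimv1 divn1 dimvS ?subvf.
have prodE : normc (\prod_(z <- conjugates iota x) z) = `|k%:~R|.
  have := congr1 (fun p => normc p.[0]) Dp.
  rewrite horner_coef0 coef_map /= Dk rmorph_int horner_prod normc_prod.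
  rewrite -(normc_real) rmorph_int => ->; rewrite normc_prod.
  by apply: eq_bigr => z _; rewrite hornerXsubC sub0r normcN.
have : 1 <= `|k%:~R : R| by rewrite -intr_norm ler1z -gtz0_ge1 normr_gt0.
rewrite -prodE normc_prod (perm_big _ (perm_to_rem xr)) big_cons.
move/le_trans; apply; apply: ler_wpM2l; first exact: normc_ge0.
set r := rem _ _.
have rB z : z \in r -> normc z <= B by move/mem_rem/conjB.
have szr' : (size r <= (\dim {:K}).-1)%N.
  by rewrite size_rem // -!subn1 leq_sub2r.
apply: le_trans (ler_weXn2l B1 szr').
elim: r rB {szr'} => [|z r IHr] rB; first by rewrite big_nil expr0.
rewrite big_cons exprS ler_pM ?normc_ge0 ?prodr_ge0//.
- by move=> *; apply: normc_ge0.
- by apply: rB; rewrite mem_head.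
- by apply: IHr => w wr; apply: rB; rewrite inE wr orbT.
Qed.

Lemma algebraic_integer_int (K : fieldExtType rat) (m : int) :
  algebraic_integer (m%:~R : K).
Proof. exact: (integral_id (intr : {rmorphism int -> K})). Qed.

(** If m clears the denominators of the minimal polynomial p of degree n, then
    m x is a root of the monic integral polynomial m^n p(X/m). *)
Lemma algebraic_integer_clear_denominator (K : fieldExtType rat) (x : K) :
  exists2 m : int, m != 0 & algebraic_integer (m%:~R * x).
Proof.
have /polyOver1P[p Dp] := minPolyOver 1%AS x.
have mon_p : p \is monic.
  have := monic_minPoly 1%AS x; rewrite Dp !monicE lead_coef_map.
  by rewrite fmorph_eq1.
have [q [m m0 Dq]] := rat_poly_scale p.
have pq i : m%:~R * p`_i = (q`_i)%:~R.
  by rewrite Dq coefZ coef_map /= mulVKf // intr_eq0.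
exists m => //.
pose n := (size p).-1.
have szp : size p = n.+1 by rewrite prednK // size_poly_gt0 monic_neq0.
pose r : {poly K} := \poly_(i < n.+1) ((m%:~R ^+ (n - i) * p`_i)%:A).
have rn : r`_n = 1.
  rewrite coef_poly ltnSn subnn expr0 mul1r.
  have /monicP := mon_p; rewrite /lead_coef -/n => ->.
  by rewrite scale1r.
have szr : size r = n.+1.
  apply/eqP; rewrite eqn_leq size_poly ltnNge; apply/negP => lt.
  by have := oner_neq0 K; rewrite -rn nth_default ?eqxx.
have mon_r : r \is monic by rewrite monicE /lead_coef szr rn.
apply: (@integral_root_monic int K intr _ r) => //.
  rewrite rootE horner_poly.
  have := minPolyxx 1%AS x; rewrite Dp horner_coef size_map_poly szp => mp0.
  apply/eqP/(etrans _ (mulr0 (m%:~R ^+ n))).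
  apply: (etrans _ (congr1 ( *%R _) mp0)); rewrite mulr_sumr.
  apply: eq_bigr => i _.
  rewrite coef_map -[_%:A]/(in_alg K _) rmorphM rmorphXn rmorph_int exprMn.
  have lein : (i <= n)%N by rewrite -ltnS ltn_ord.
  rewrite -[X in _ = _ ^+ X * _](subnK lein) exprD -!mulrA; congr (_ * _).
  by rewrite mulrCA.
move=> c /(nthP 0)[i ltir <-].
have [ltin|lein] := ltnP i n; last first.
  have -> : i = n by apply/eqP; rewrite eqn_leq lein -ltnS -szr ltir.
  by rewrite rn; apply: integral1.
rewrite coef_poly ltnS ltnW // -(subnSK ltin) exprSr -mulrA pq.
rewrite -rmorphXn -rmorphM scaler_int; exact: algebraic_integer_int.
Qed.

(** * Continued fractions with real partial quotients at least 1 *)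

(** The solution w of w_0 = u, w_1 = v, w_(n+2) = x_(n+1) w_(n+1) + w_n. The
    n-th convergent of x has denominator w_(n+1) for (u, v) = (0, 1) and numerator
    w_(n+1) for (u, v) = (1, x_0). Keeping u and v free treats both at once. *)
Fixpoint three_term (F : comNzRingType) (x : nat -> F) (u v : F) (n : nat) : F :=
  if n is m.+1 then
    if m is k.+1 then x m * three_term x u v m + three_term x u v k else v
  else u.

Lemma three_termSS (F : comNzRingType) (x : nat -> F) (u v : F) n :
  three_term x u v n.+2 = x n.+1 * three_term x u v n.+1 + three_term x u v n.
Proof. by []. Qed.

Lemma nat_ind2 (P : nat -> Prop) :
  P 0%N -> P 1%N -> (forall n, P n -> P n.+1 -> P n.+2) -> forall n, P n.
Proof.
move=> P0 P1 PS n; suff: P n /\ P n.+1 by case.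
by elim: n => [//|n [Pn Pn1]]; split=> //; apply: PS.
Qed.

(** The denominators of x are the numerators of the shifted sequence. Together
    with [three_term_first] this relates the recurrence, which adds terms at the
    end, to the definition of [convergent], which removes the first term. *)
Lemma three_term_shift (F : comNzRingType) (x : nat -> F) n :
  three_term x 0 1 n.+1 = three_term (fun k => x k.+1) 1 (x 1%N) n.
Proof.
elim/nat_ind2: n => [//||n IHn IHn1]; first by rewrite /= mulr1 addr0.
by rewrite [LHS]three_termSS IHn1 IHn.
Qed.

(** The initial term only translates the convergents, so it can be taken to
    be 0 in everything that follows. *)
Lemma three_term_affine (F : comNzRingType) (x : nat -> F) n :
  three_term x 1 (x 0%N) n = x 0%N * three_term x 0 1 n + three_term x 1 0 n.
Proof.
elim/nat_ind2: n => [||n IHn IHn1]; [rewrite /=; ring | rewrite /=; ring |].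
by rewrite !three_termSS IHn1 IHn; ring.
Qed.

Lemma three_term_first (F : comNzRingType) (x : nat -> F) n :
  three_term x 1 (x 0%N) n.+1 =
  x 0%N * three_term (fun k => x k.+1) 1 (x 1%N) n + three_term (fun k => x k.+1) 0 1 n.
Proof.
elim/nat_ind2: n => [||n IHn IHn1]; [rewrite /=; ring | rewrite /=; ring |].
by rewrite [LHS]three_termSS IHn1 IHn !(three_termSS (fun k => x k.+1)); ring.
Qed.

Lemma three_term_casoratian (F : comNzRingType) (x : nat -> F) n :
  three_term x 1 0 n.+1 * three_term x 0 1 n - three_term x 1 0 n * three_term x 0 1 n.+1 = - (-1) ^+ n.
Proof.
elim: n => [|n IHn]; first by rewrite /= mulr1 mulr0 sub0r expr0.
rewrite !three_termSS exprS mulN1r opprK -[RHS]opprK -IHn; ring.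
Qed.

Lemma rmorph_three_term (F G : comNzRingType) (f : {rmorphism F -> G})
    (x : nat -> F) (y : nat -> G) u v n :
  (forall k, (1 <= k)%N -> f (x k) = y k) ->
  f (three_term x u v n) = three_term y (f u) (f v) n.
Proof.
move=> fx; elim/nat_ind2: n => [||n IHn IHn1] //.
by rewrite !three_termSS rmorphD rmorphM IHn1 IHn fx.
Qed.

Lemma convergentE (F : fieldType) (x : nat -> F) n :
  (forall k m, three_term (fun i => x (k + i)%N) 0 1 m.+1 != 0) ->
  convergent x n = x 0%N + three_term x 1 0 n.+1 / three_term x 0 1 n.+1.
Proof.
move=> q0; have : convergent x n = three_term x 1 (x 0%N) n.+1 / three_term x 0 1 n.+1.
  elim: n x q0 => [|n IHn] x q0; first by rewrite /= divr1.
  have q0' k m : three_term (fun i => x (k + i).+1) 0 1 m.+1 != 0 by apply: (q0 k.+1).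
  rewrite [LHS]/= (IHn _ q0') invf_div three_term_first (three_term_shift _ n.+1).
  by rewrite mulrDl mulfK // -(three_term_shift x n.+1) (q0 0%N).
by move=> ->; rewrite three_term_affine mulrDl mulfK // (q0 0%N).
Qed.

Section PositiveTerms.
Variables (R : realType) (a : nat -> R).
Hypothesis a1 : forall n, (1 <= n)%N -> 1 <= a n.

Local Notation q := (three_term a 0 1).

Lemma denominator_ge n : 0 <= q n /\ 1 <= q n.+1.
Proof.
elim: n => [|n [q0 q1]]; first by [].
split; first by apply: le_trans q1.
rewrite three_termSS -[leLHS]addr0 lerD //.
apply: le_trans (q1) _; rewrite ler_peMl ?a1 //.
by apply: le_trans q1; apply: ler01.
Qed.

Lemma denominator_ge0 n : 0 <= q n. Proof. by case: (denominator_ge n). Qed.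
Lemma denominator_ge1 n : 1 <= q n.+1. Proof. by case: (denominator_ge n). Qed.
Lemma denominator_gt0 n : 0 < q n.+1.
Proof. exact: lt_le_trans (denominator_ge1 n). Qed.

Lemma denominator_mul_le n : a n.+1 * q n.+1 <= q n.+2.
Proof. by rewrite three_termSS lerDl denominator_ge0. Qed.

Lemma denominator_mono n : q n <= q n.+1.
Proof.
case: n => [|n]; first by rewrite ler01.
apply: le_trans (denominator_mul_le n).
by rewrite ler_peMl ?denominator_ge0 ?a1.
Qed.

(** A crude growth, enough for the convergence of the convergents. *)
Lemma denominator_ge_nat n : n.+1%:R <= q n.+2.
Proof.
elim: n => [|n IHn]; first exact: denominator_ge1.
rewrite [in leRHS]three_termSS -natr1 lerD ?denominator_ge1 //.
by apply: le_trans IHn _; rewrite ler_peMl ?denominator_ge0 ?a1.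
Qed.

Let g n := (q n.+1 * q n.+2)^-1.
Let t n := three_term a 1 0 n.+1 / q n.+1.

Let g_gt0 n : 0 < g n.
Proof. by rewrite invr_gt0 mulr_gt0 ?denominator_gt0. Qed.

Let g_half n : g n.+1 <= g n / 2.
Proof.
rewrite /g -invfM lef_pV2 ?posrE ?mulr_gt0 ?denominator_gt0 //.
rewrite -mulrA mulrCA ler_wpM2l ?denominator_ge0 // three_termSS mulr_natr mulr2n lerD //.
by rewrite (le_trans (denominator_mono _)) // ler_peMl ?denominator_ge0 ?a1.
Qed.

Let t_step n : t n.+1 - t n = (-1) ^+ n * g n.
Proof.
have := three_term_casoratian a n.+1; rewrite exprS mulN1r opprK => W.
rewrite /t /g -W; field.
by rewrite !gt_eqF ?denominator_gt0.
Qed.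

(** The successive differences alternate in sign and decrease in modulus. *)
Lemma convergent_diff_bounds n k :
  0 <= (-1) ^+ n * (t (n + k) - t n) <= g n.
Proof.
elim: k n => [|k IHk] n.
  by rewrite addn0 subrr mulr0 lexx ltW.
have := IHk n.+1; rewrite addSnnS exprS => /andP[h1 h2].
have -> : (-1) ^+ n * (t (n + k.+1) - t n) =
    g n - (-1) * (-1) ^+ n * (t (n + k.+1) - t n.+1).
  have -> : t (n + k.+1) - t n = (t (n + k.+1) - t n.+1) + (t n.+1 - t n) by ring.
  rewrite t_step mulrDr mulrA -expr2 sqrr_sign; ring.
have := g_half n; have := g_gt0 n; lra.
Qed.

(** The gaps at least halve at each step, so the second difference cannot cancel
    more than half of the first one. *)
Lemma convergent_diff_lower n k :
  g n / 2 <= (-1) ^+ n * (t (n + k.+1) - t n).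
Proof.
have := convergent_diff_bounds n.+1 k; rewrite addSnnS exprS => /andP[h1 h2].
have -> : (-1) ^+ n * (t (n + k.+1) - t n) =
    g n - (-1) * (-1) ^+ n * (t (n + k.+1) - t n.+1).
  have -> : t (n + k.+1) - t n = (t (n + k.+1) - t n.+1) + (t n.+1 - t n) by ring.
  rewrite t_step mulrDr mulrA -expr2 sqrr_sign; ring.
have := g_half n; lra.
Qed.

Lemma cvg_convergents : cvgn t.
Proof.
apply/cauchy_cvgP/cauchy_exP => e e0.
near \oo => n; exists (t n.+1).
exists n.+1 => //= m /= ltnm.
rewrite /ball /= -(subnKC ltnm) distrC.
have /andP[h1 h2] := convergent_diff_bounds n.+1 (m - n.+1).
rewrite -[ltLHS]mul1r -(normr_sign _ n.+1) -normrM ger0_norm //.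
apply: le_lt_trans h2 _.
have ne : n.+1%:R^-1 < e by near: n; exact: near_infty_natSinv_lt (PosNum e0).
apply: le_lt_trans ne; rewrite /g lef_pV2 ?posrE ?mulr_gt0 ?denominator_gt0 //.
rewrite (le_trans (denominator_ge_nat _)) // ler_peMr ?denominator_ge0 //.
exact: denominator_ge1.
Unshelve. all: by end_near.
Qed.

Lemma convergent_error_bounds n :
  g n / 2 <= (-1) ^+ n * (limn t - t n) <= g n.
Proof.
have cv : (-1) ^+ n * (t m - t n) @[m --> \oo] --> (-1) ^+ n * (limn t - t n).
  by apply: cvgMr; apply: cvgB cvg_convergents (cvg_cst _).
apply/andP; split.
  apply: (cvgr_to_ge cv); exists n.+1 => //= m /= ltnm.
  by rewrite -(subnKC ltnm) addSnnS convergent_diff_lower.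
apply: (cvgr_to_le cv); exists n => //= m /= lenm.
by rewrite -(subnKC lenm); have /andP[] := convergent_diff_bounds n (m - n).
Qed.

End PositiveTerms.

Lemma cvg_real_complex (R : realType) (z : R[i]) (u : nat -> R) (l : R) :
  u n @[n --> \oo] --> l ->
  ((z + (u n)%:C%C : R[i]^o) @[n --> \oo] --> (z + l%:C%C : R[i]^o)).
Proof.
move=> ul; apply/cvgrPdist_lt => -[e e'] /=; rewrite ltcE /= => /andP[/eqP -> e0].
move/cvgrPdist_lt/(_ e e0): ul; apply: filterS => n un.
rewrite opprD addrACA subrr add0r -raddfB.
by rewrite normc_def /= expr0n addr0 sqrtr_sqr ltcR.
Qed.

(** Only the initial term may fail to be real: the limit is that of the real
    convergents with initial term 0, translated, since R[i]^o carries the topology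
    of the modulus. *)
Lemma continued_fraction_real_tail (R : realType) (x : nat -> R[i])
    (a : nat -> R) :
  (forall n, (1 <= n)%N -> x n = (a n)%:C%C) ->
  (forall n, (1 <= n)%N -> 1 <= a n) ->
  continued_fraction x =
  x 0%N + (limn (fun n => three_term a 1 0 n.+1 / three_term a 0 1 n.+1))%:C%C.
Proof.
move=> xa a1; apply: (@cvg_lim R[i]^o); first exact: norm_hausdorff.
have xc u v n : three_term x u%:C%C v%:C%C n = (three_term a u v n)%:C%C.
  by apply/esym/(@rmorph_three_term _ _ (real_complex R)) => k /xa.
have -> : convergent x =
    (fun n => x 0%N + (three_term a 1 0 n.+1 / three_term a 0 1 n.+1)%:C%C).
  apply/funext => n; rewrite convergentE.
    by rewrite (xc 1 0) (xc 0 1) -fmorph_div.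
  move=> k m.
  rewrite -(@rmorph_three_term _ _ (real_complex R) (fun i => a (k + i)%N) _ 0 1);
    last by move=> i i1 /=; rewrite xa // addn_gt0 i1 orbT.
  rewrite fmorph_eq0 gt_eqF // denominator_gt0 // => i i1.
  by rewrite a1 // addn_gt0 i1 orbT.
by apply: cvg_real_complex; apply: cvg_convergents.
Qed.

Section Ratio.
Variables (R : realType) (a b : nat -> R).
Hypothesis a1 : forall n, (1 <= n)%N -> 1 <= a n.
Hypothesis b1 : forall n, (1 <= n)%N -> 1 <= b n.

(** The denominator w_(n+2) is a weighted sum of w_(n+1) and w_n in which the
    first term carries at least half of the weight. A gain of 2 e on the
    coefficient of w_(n+1) is therefore a gain of at least e on w_(n+2), even if
    only a common factor m is known on the two previous denominators. *)
Lemma denominator_ratio_step (m e : R) n :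
  0 <= m -> 0 <= e -> (1 + 2 * e) * b n.+1 <= a n.+1 ->
  m * three_term b 0 1 n <= three_term a 0 1 n ->
  m * three_term b 0 1 n.+1 <= three_term a 0 1 n.+1 ->
  m * (1 + e) * three_term b 0 1 n.+2 <= three_term a 0 1 n.+2.
Proof.
move=> m0 e0 ab h0 h1; rewrite !three_termSS.
have q0 := denominator_ge0 b1 n; have q1 := denominator_ge0 b1 n.+1.
have bq : three_term b 0 1 n <= b n.+1 * three_term b 0 1 n.+1.
  apply: le_trans (denominator_mono b1 n) _.
  by rewrite ler_peMl // b1.
have b0 : 0 <= b n.+1 by rewrite (le_trans ler01) ?b1.
apply: le_trans (_ : (1 + 2 * e) * b n.+1 * (m * three_term b 0 1 n.+1)
   + m * three_term b 0 1 n <= _); last first.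
  apply: lerD => //; apply: ler_pM => //; rewrite ?mulr_ge0 //.
  by rewrite addr_ge0 ?mulr_ge0.
have : 0 <= m * e * (b n.+1 * three_term b 0 1 n.+1 - three_term b 0 1 n).
  by rewrite !mulr_ge0 // subr_ge0.
lra.
Qed.

(** Two steps of [denominator_ratio_step] multiply the lower bound on the ratio
    of the denominators by 1 + 2/n = (n + 2)/n, and the product of these factors
    telescopes to a linear bound. *)
Lemma denominator_ratio_linear N :
  (forall n, (N <= n)%N -> (1 + 8 / n%:R) * b n <= a n) ->
  exists2 c : R, 0 < c & \forall n \near \oo,
    c * n%:R * three_term b 0 1 n <= three_term a 0 1 n.
Proof.
move=> ab; pose N1 := maxn N 2.
have N1_gt0 : (0 < N1)%N by rewrite /N1; lia.
pose r n := three_term a 0 1 n / three_term b 0 1 n.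
have rE n : (0 < n)%N -> r n * three_term b 0 1 n = three_term a 0 1 n.
  by case: n => // n _; rewrite /r divfK // gt_eqF // denominator_gt0.
have r_gt0 n : (0 < n)%N -> 0 < r n.
  by case: n => // n _; rewrite divr_gt0 // denominator_gt0.
(* Starting value of the lower bound c * n, valid at two consecutive indices. *)
pose c := Num.min (r N1) (r N1.+1) / N1%:R.
have N1R : 0 < N1%:R :> R by rewrite ltr0n.
have c0 : 0 < c by rewrite divr_gt0 // lt_min !r_gt0.
(* The bound is proved at n = N1 + 2 k with constant c and carried over to n + 1
   unchanged; halving c covers the odd offsets. *)
exists (c / 2); first by rewrite divr_gt0.
have key k : c * (N1 + k.*2)%:R * three_term b 0 1 (N1 + k.*2)%N
      <= three_term a 0 1 (N1 + k.*2)%N /\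
    c * (N1 + k.*2)%:R * three_term b 0 1 (N1 + k.*2).+1
      <= three_term a 0 1 (N1 + k.*2).+1.
  elim: k => [|k].
    rewrite addn0 /c divfK ?gt_eqF // -!rE //.
    by split; rewrite ler_wpM2r ?denominator_ge0 // ge_min lexx ?orbT.
  have -> : (N1 + k.+1.*2)%N = (N1 + k.*2).+2 by lia.
  set n := (N1 + k.*2)%N => -[h0 h1].
  have nN : (N <= n)%N by rewrite /n /N1; lia.
  have n2 : (2 <= n)%N by rewrite /n /N1; lia.
  have n2R : 2 <= n%:R :> R by rewrite ler_nat.
  have n0 : 0 < n%:R :> R by lra.
  have m0 : 0 <= c * n%:R by rewrite mulr_ge0 // ltW.
  have step (x : nat) : (n <= x <= n.+2)%N ->
      (1 + 2 * (2 / n%:R)) * b x <= a x.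
    move=> nx; apply: le_trans (ab x _); last lia.
    rewrite ler_wpM2r ?(le_trans ler01) ?b1 //; first lia.
    rewrite lerD2l mulrA (_ : 2 * 2 = 4); last by ring.
    rewrite ler_pdivrMr // mulrAC ler_pdivlMr; last by rewrite ltr0n; lia.
    have : x%:R <= n.+2%:R :> R by rewrite ler_nat; lia.
    by rewrite -!natr1; lra.
  have e0 : 0 <= 2 / n%:R :> R by rewrite divr_ge0.
  have fac : c * n.+2%:R = c * n%:R * (1 + 2 / n%:R).
    by rewrite -!natr1; field; rewrite gt_eqF.
  have h2 : c * n.+2%:R * three_term b 0 1 n.+2 <= three_term a 0 1 n.+2.
    by rewrite fac; apply: denominator_ratio_step => //; apply: step; lia.
  split=> //; rewrite fac; apply: denominator_ratio_step => //.
    by apply: step; lia.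
  apply: le_trans h2; rewrite ler_wpM2r ?denominator_ge0 // ler_wpM2l ?(ltW c0) //.
  by rewrite ler_nat; lia.
exists N1 => // n /= N1n.
have [k [i [i2 ->]]] : exists k i, (i < 2)%N /\ n = (N1 + k.*2 + i)%N.
  exists (n - N1)./2, (odd (n - N1)); split; first by case: odd.
  by rewrite -addnA [(_.*2 + _)%N]addnC odd_double_half subnKC.
have n2 : 2 <= (N1 + k.*2)%:R :> R by rewrite ler_nat /N1; lia.
have [h0 h1] := key k.
case: i i2 => [|[|//]] _; rewrite ?addn0 ?addn1.
  apply: le_trans h0; rewrite ler_wpM2r ?denominator_ge0 // ler_wpM2r //; lra.
apply: le_trans h1; rewrite ler_wpM2r ?denominator_ge0 // -mulrA ler_wpM2l ?(ltW c0) //.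
by rewrite -[(_ + _).+1%:R]natr1; lra.
Qed.

Lemma denominator_ratio_large N (B : R) :
  (forall n, (N <= n)%N -> (1 + 8 / n%:R) * b n <= a n) ->
  \forall n \near \oo, B * three_term b 0 1 n <= three_term a 0 1 n.
Proof.
case/denominator_ratio_linear => c c0 cab; near=> n.
apply: le_trans (near cab n _) => //; rewrite ler_wpM2r ?denominator_ge0 //.
rewrite mulrC -ler_pdivrMr //; near: n; exact: nbhs_infty_ger.
Unshelve. all: by end_near.
Qed.
End Ratio.

Arguments three_term : simpl never.

(** * Sequences growing faster than the sum of their past *)

Lemma powR_le1D (R : realType) (gamma x : R) :
  0 <= gamma <= 1 -> 0 <= x -> x `^ gamma <= 1 + x.
Proof.
move=> /andP[g0 g1] x0; have [x1|x1] := leP x 1.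
  apply: (@le_trans _ _ 1); last by rewrite lerDl.
  have -> : 1 = 1 `^ gamma by rewrite powR1.
  by rewrite ge0_ler_powR ?nnegrE.
apply: (@le_trans _ _ x); last by rewrite lerDr.
by rewrite -[leRHS]powRr1 // ler_powR // ltW.
Qed.

(** The quotient of d^n by d^(n gamma) is an exponential in n, and
    exp y >= (y/4)^4 for y >= 0 beats any multiple of n^3. *)
Lemma powR_sub_exponential (R : realType) (gamma C : R) (d : nat) :
  0 < gamma < 1 -> (2 <= d)%N ->
  \forall n \near \oo, C * n%:R ^+ 3 * d%:R `^ (n%:R * gamma) <= d%:R ^+ n.
Proof.
move=> /andP[g0 g1] d2.
have d0 : 0 < d%:R :> R by rewrite ltr0n; lia.
have [L LE] : exists L : R, L = (1 - gamma) * ln d%:R by eexists.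
have L0 : 0 < L by rewrite LE mulr_gt0 ?subr_gt0 // ln_gt0 // ltr1n.
near=> n.
have dn : d%:R ^+ n = d%:R `^ (n%:R * gamma) * expR (n%:R * L) :> R.
  rewrite -powR_mulrn ?ltW // {1}(_ : n%:R = n%:R * gamma + n%:R * (1 - gamma) :> R);
    last by ring.
  rewrite powRD; last by apply/implyP => _; rewrite gt_eqF.
  by congr (_ * _); rewrite LE /powR gt_eqF // mulrA.
rewrite dn mulrC ler_wpM2l ?powR_ge0 //.
have expL : n%:R ^+ 4 * (L / 4) ^+ 4 <= expR (n%:R * L).
  rewrite (_ : n%:R * L = 4%:R * (n%:R * (L / 4))); last by field.
  rewrite expRM_natl -exprMn lerXn2r ?nnegrE ?expR_ge0 ?mulr_ge0 ?divr_ge0 ?(ltW L0) //.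
  by apply: le_trans (expR_ge1Dx _); rewrite lerDr.
apply: le_trans expL; rewrite [n%:R ^+ 4]exprS mulrAC ler_wpM2r ?exprn_ge0 //.
rewrite -ler_pdivrMr ?exprn_gt0 ?divr_gt0 //.
by near: n; exact: nbhs_infty_ger.
Unshelve. all: by end_near.
Qed.

(** Let W_n be (u_1 + ... + u_n)/d^n. If the inequality fails from some point on,
    then W_(n+1) <= W_n + (W_(n+1) + 2)/(n + 1)^2 for large n: the sum of the
    error terms is at most C n (W_n + 2) d^(n gamma), which is negligible against
    d^n. Hence (W_n + 2)(n + 1)/n does not increase, because
    1 - 1/(n + 1)^2 = n (n + 2)/(n + 1)^2, so W is bounded and so is u_n/d^n. *)
Lemma growth_excess (R : realType) (gamma C : R) (d : nat) (u : nat -> R) :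
  0 < gamma < 1 -> (2 <= d)%N -> 0 <= C -> (forall n, 0 <= u n) ->
  (forall B N, exists2 n, (N <= n)%N & B * d%:R ^+ n < u n) ->
  forall N, exists2 n, (N <= n)%N &
    (d%:R - 1) * (\sum_(1 <= i < n.+1) u i) +
      C * (\sum_(1 <= i < n.+2) (u i `^ gamma + d%:R `^ (i%:R * gamma)))
    < u n.+1.
Proof.
move=> g01 d2 C0 u0 u_unb N; apply: contrapT => Hn.
have {}Hn n : (N <= n)%N -> u n.+1 <= (d%:R - 1) * (\sum_(1 <= i < n.+1) u i) +
    C * (\sum_(1 <= i < n.+2) (u i `^ gamma + d%:R `^ (i%:R * gamma))).
  by move=> Nn; rewrite leNgt; apply/negP => lt; apply: Hn; exists n.
have /andP[g0 g1] := g01.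
have d0 : 0 < d%:R :> R by rewrite ltr0n; lia.
have d1 : 1 <= d%:R :> R by rewrite ler1n; lia.
pose U n := \sum_(1 <= i < n.+1) u i.
have U0 n : 0 <= U n by apply: sumr_ge0.
have US n : U n.+1 = U n + u n.+1 by rewrite /U big_nat_recr.
have uU i n : (1 <= i < n.+1)%N -> u i <= U n.
  move=> i1n; rewrite /U (bigD1_seq i) ?mem_index_iota ?iota_uniq //=.
  by rewrite lerDl sumr_ge0.
pose W n := U n / d%:R ^+ n.
have W0 n : 0 <= W n by rewrite divr_ge0 // exprn_ge0 // ltW.
have UW n : U n = W n * d%:R ^+ n by rewrite divfK // gt_eqF // exprn_gt0.
have Hbd n : \sum_(1 <= i < n.+1) (u i `^ gamma + d%:R `^ (i%:R * gamma)) <=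
    n%:R * ((W n + 2) * d%:R `^ (n%:R * gamma)).
  have -> : n%:R * ((W n + 2) * d%:R `^ (n%:R * gamma)) =
      \sum_(1 <= i < n.+1) ((W n + 2) * d%:R `^ (n%:R * gamma)).
    by rewrite sumr_const_nat subn1 /= mulr_natl.
  rewrite !big_nat; apply: ler_sum => i ilt.
  have h1 : u i `^ gamma <= (1 + W n) * d%:R `^ (n%:R * gamma).
    apply: le_trans (_ : U n `^ gamma <= _).
      by rewrite ge0_ler_powR ?nnegrE ?(ltW g0) ?uU.
    rewrite UW powRM ?exprn_ge0 ?(ltW d0) // -powR_mulrn ?(ltW d0) // -powRrM.
    by rewrite ler_wpM2r ?powR_ge0 // powR_le1D // (ltW g0) (ltW g1).
  have h2 : d%:R `^ (i%:R * gamma) <= d%:R `^ (n%:R * gamma) :> R.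
    by rewrite ler_powR // ler_wpM2r ?(ltW g0) // ler_nat; lia.
  lra.
have [N1 _ HN1] := powR_sub_exponential C g01 d2.
pose N0 := (maxn N N1).+1.
(* The factor n.+1 / n compensates the error terms 1 / (n + 1)^2. *)
pose V n := (W n + 2) * (n.+1%:R / n%:R).
have VS n : (N0 <= n)%N -> V n.+1 <= V n.
  move=> nN0.
  have n0 : 0 < n%:R :> R by rewrite ltr0n; rewrite /N0 in nN0; lia.
  have Dn0 : 0 < d%:R ^+ n.+1 :> R by rewrite exprn_gt0.
  have H1 : C * n.+1%:R ^+ 3 * d%:R `^ (n.+1%:R * gamma) <= d%:R ^+ n.+1.
    by apply: HN1; rewrite /= /N0 in nN0 *; lia.
  have H2 : u n.+1 <= (d%:R - 1) * U n +
      C * (n.+1%:R * ((W n.+1 + 2) * d%:R `^ (n.+1%:R * gamma))).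
    apply: le_trans (Hn n _) _; first by rewrite /N0 in nN0; lia.
    by rewrite lerD2l ler_wpM2l.
  have H3 : W n.+1 * n.+1%:R ^+ 2 <= W n * n.+1%:R ^+ 2 + (W n.+1 + 2).
    rewrite -(ler_pM2r Dn0).
    have -> : W n.+1 * n.+1%:R ^+ 2 * d%:R ^+ n.+1
        = (U n + u n.+1) * n.+1%:R ^+ 2 by rewrite -US UW; ring.
    have -> : (W n * n.+1%:R ^+ 2 + (W n.+1 + 2)) * d%:R ^+ n.+1
        = d%:R * U n * n.+1%:R ^+ 2 + (W n.+1 + 2) * d%:R ^+ n.+1.
      by rewrite UW [d%:R ^+ n.+1]exprS; ring.
    have W2 : 0 <= W n.+1 + 2 by rewrite addr_ge0.
    have := ler_wpM2l W2 H1.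
    have := ler_wpM2r (sqr_ge0 n.+1%:R) H2.
    lra.
  rewrite /V !mulrA ler_pdivrMr ?ltr0n // mulrAC ler_pdivlMr //.
  have := W0 n; have := W0 n.+1.
  move: H3 n0; rewrite -!natr1; move: (n%:R) (W n) (W n.+1) => x w w'.
  by lra.
have VN0 k : V (N0 + k)%N <= V N0.
  elim: k => [|k IHk]; first by rewrite addn0.
  by rewrite addnS (le_trans (VS _ _)) // leq_addr.
have [n nN0] := u_unb (V N0) N0.
apply/negP; rewrite -leNgt.
apply: le_trans (uU n n _) _; first by rewrite /N0 in nN0; lia.
rewrite UW ler_wpM2r ?exprn_ge0 ?(ltW d0) //.
apply: le_trans (_ : V n <= _); last by rewrite -(subnKC nN0).
rewrite /V; have n0 : 0 < n%:R :> R by rewrite ltr0n; rewrite /N0 in nN0; lia.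
rewrite mulrA ler_pdivlMr // -natr1; have := W0 n; lra.
Qed.

(** * Comparing the partial quotients of the different continued fractions *)

Lemma limn_einf_gt0_near (R : realType) (v : nat -> R) :
  (0 < limn_einf (fun n => (v n)%:E))%E ->
  exists2 c : R, 0 < c & \forall n \near \oo, c <= v n.
Proof.
rewrite limn_einf_lim.
have /cvg_lim -> // := @cvg_einfs_sup R (fun n => (v n)%:E).
case/ereal_sup_gt => _ [N _ <-] infN.
have {infN}c0 : (0 < ereal_inf (sdrop (fun n => (v n)%:E) N))%E by exact: infN.
have leN n : (N <= n)%N -> (ereal_inf (sdrop (fun n => (v n)%:E) N) <= (v n)%:E)%E.
  by move=> Nn; apply: ereal_inf_lbound; exists n.
move: c0 leN; case: ereal_inf => [c| |] // c0 leN.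
- rewrite lte_fin in c0; exists c => //; exists N => // n /= /leN.
- by exists 1 => //; exists N => // n /= /leN; rewrite leye_eq.
Qed.

Lemma limn_esup_pinfty_unbounded (R : realType) (v : nat -> R) :
  limn_esup (fun n => (v n)%:E) = +oo%E ->
  forall B N, exists2 n, (N <= n)%N & B < v n.
Proof.
rewrite limn_esup_lim.
have /cvg_lim -> // := @cvg_esups_inf R (fun n => (v n)%:E) => voo B N.
have : (B%:E < ereal_sup (sdrop (fun n => (v n)%:E) N))%E.
  apply: (@lt_le_trans _ _ +oo%E); first exact: ltry.
  by rewrite -voo; apply: ereal_inf_lbound; exists N.
by case/ereal_sup_gt => _ [n /= Nn <-]; rewrite lte_fin; exists n.
Qed.

Section Log2.
Variable R : realType.
Implicit Types x y : R.

Lemma ln2_gt0 : 0 < ln 2 :> R. Proof. by rewrite ln_gt0 ?ltr1n. Qed.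

Lemma powR_log2 x : 0 < x -> 2 `^ log2 x = x.
Proof.
move=> x0; rewrite /powR pnatr_eq0 /= /log2 divfK ?gt_eqF ?ln2_gt0 //.
by rewrite lnK ?posrE.
Qed.

Lemma log2_powR y : log2 (2 `^ y) = y.
Proof. by rewrite /log2 ln_powR mulfK // gt_eqF ?ln2_gt0. Qed.

Lemma ler_log2 x y : 0 < x -> x <= y -> log2 x <= log2 y.
Proof.
move=> x0 xy; rewrite ler_wpM2r ?invr_ge0 ?(ltW ln2_gt0) // ler_ln ?posrE //.
exact: lt_le_trans xy.
Qed.

Lemma log2M x y : 0 < x -> 0 < y -> log2 (x * y) = log2 x + log2 y.
Proof. by move=> x0 y0; rewrite /log2 lnM ?posrE // mulrDl. Qed.

Lemma log2_ge0 x : 1 <= x -> 0 <= log2 x.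
Proof. by move=> x1; exact: divr_ge0 (ln_ge0 x1) (ltW ln2_gt0). Qed.
End Log2.

Section ColumnRatio.
Variables (R : realType) (M : nat) (a : nat -> nat -> R).
Hypothesis ha1 : forall n j, (1 <= n)%N -> (1 <= j <= M)%N -> 1 <= a n j.
Hypothesis hliminf : forall j, (1 <= j < M)%N ->
  (0 < limn_einf (fun n =>
          (Num.sqrt n%:R * (a n j / a n j.+1 - 1))%:E))%E.

(** A relative gap c/sqrt n with c > 0 is eventually at least 8/n, the size for
    which two steps of the recurrence gain a factor 1 + 2/n. *)
Lemma adjacent_ratio j : (1 <= j < M)%N ->
  \forall n \near \oo, (1 + 8 / n%:R) * a n j.+1 <= a n j.
Proof.
move=> jM; have [c c0 cv] := limn_einf_gt0_near (hliminf jM); near=> n.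
have n0 : (0 < n)%N by near: n; exists 1%N.
have nR : 0 < n%:R :> R by rewrite ltr0n.
have s0 : 0 < Num.sqrt n%:R :> R by rewrite sqrtr_gt0.
have a0 : 0 < a n j.+1 by rewrite (lt_le_trans ltr01) // ha1 //; lia.
have cn : c <= Num.sqrt n%:R * (a n j / a n j.+1 - 1) by near: n.
rewrite -ler_pdivlMr // -lerBrDl; apply: le_trans (_ : c / Num.sqrt n%:R <= _).
  rewrite ler_pdivrMr // mulrAC ler_pdivlMr //.
  rewrite -[X in _ <= _ * X](sqr_sqrtr (ltW nR)) expr2 mulrA ler_wpM2r ?(ltW s0) //.
  rewrite mulrC -ler_pdivrMr //.
  have c8 : 0 <= 8 / c by rewrite divr_ge0 ?(ltW c0).
  rewrite -(ger0_norm c8) -sqrtr_sqr ler_wsqrtr //.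
  by near: n; exact: nbhs_infty_ger.
by rewrite ler_pdivrMr // mulrC.
Unshelve. all: by end_near.
Qed.

Lemma column_ratio : \forall n \near \oo,
  forall j k, (1 <= j < k)%N -> (k <= M)%N -> (1 + 8 / n%:R) * a n k <= a n j.
Proof.
have : \forall n \near \oo, forall i : 'I_M, (0 < i)%N ->
    (1 + 8 / n%:R) * a n i.+1 <= a n i.
  apply: filter_forall => i; case: (posnP i) => [->|i0]; first exact: nearW.
  have iM : (1 <= i < M)%N by rewrite i0 ltn_ord.
  by apply: filterS (adjacent_ratio iM) => n.
move=> near_adj; near=> n.
have n0 : (0 < n)%N by near: n; exists 1%N.
have adj j : (1 <= j < M)%N -> (1 + 8 / n%:R) * a n j.+1 <= a n j.
  by move=> /andP[j1 jM]; apply: (near near_adj n _ (Ordinal jM)).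
have f1 : 1 <= 1 + 8 / n%:R :> R by rewrite lerDl divr_ge0.
move=> j k /andP[j1 jk] kM; have k1 : (1 <= k)%N by lia.
rewrite -(subnKC jk) in kM *; elim: (k - _)%N kM => [|i IHi] kM.
  by rewrite addn0 adj //; lia.
apply: le_trans (IHi _); last by lia.
rewrite ler_wpM2l ?(le_trans ler01) //.
apply: le_trans (adj _ _); last by lia.
rewrite addnS ler_peMl // (le_trans ler01) // ha1 //; lia.
Unshelve. all: by end_near.
Qed.
End ColumnRatio.

(** The binary logarithm of a bound for [growth_bound] at every number between 1
    and 2^(u n), with the maximum replaced by a sum. It is at least 1, so it also
    absorbs constants. *)
Definition log_growth (R : realType) (gamma : R) (d : nat) (u : nat -> R) n : R :=
  u n `^ gamma + d%:R `^ (n%:R * gamma).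

Lemma log_growth_ge1 (R : realType) (gamma : R) (d : nat) (u : nat -> R) n :
  0 <= gamma -> (1 <= d)%N -> 1 <= log_growth gamma d u n.
Proof.
move=> g0 d1; apply: le_trans (_ : d%:R `^ (n%:R * gamma) <= _).
  by rewrite -[leLHS](powRr0 d%:R) ler_powR ?mulr_ge0 ?ler1n.
by rewrite lerDr powR_ge0.
Qed.

Section Size.
Variables (R : realType) (M d : nat) (gamma : R) (a : nat -> nat -> R).
Hypotheses (hM : (0 < M)%N) (hgamma : 0 < gamma < 1) (hd : (2 <= d)%N).
Hypothesis ha1 : forall n j, (1 <= n)%N -> (1 <= j <= M)%N -> 1 <= a n j.
Hypothesis hliminf : forall j, (1 <= j < M)%N ->
  (0 < limn_einf (fun n =>
          (Num.sqrt n%:R * (a n j / a n j.+1 - 1))%:E))%E.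
Hypothesis ha_max : forall n, (1 <= n)%N ->
       a n 1%N < Num.max (a n M * 2 `^ (log2 (a n M) `^ gamma))
                         (2 `^ (d%:R `^ (n%:R * gamma))).
Hypothesis hlimsup : forall j, (1 <= j <= M)%N ->
       limn_esup (fun n => (a n j `^ (d%:R ^+ n)^-1)%:E) = +oo%E.

(** u n is the logarithm of the largest term of row n. From some row on the terms
    decrease along the row and the first one is at most the last one times
    2^(log_growth), so that all logarithms lie within log_growth of u n; the
    constant C takes care of the finitely many other rows. *)
Lemma log_size : exists u : nat -> R, exists2 C : R, 0 <= C &
  [/\ forall n, 0 <= u n,
      forall B N, exists2 n, (N <= n)%N & B * d%:R ^+ n < u n &
      forall n j, (1 <= n)%N -> (1 <= j <= M)%N ->
        u n - C * log_growth gamma d u n <= log2 (a n j) <= u n].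
Proof.
have /andP[g0 g1] := hgamma.
pose A n := \big[Num.max/1]_(1 <= j < M.+1) a n j.
have A1 n : 1 <= A n by apply: bigmax_ge_id.
have aA n j : (1 <= j <= M)%N -> a n j <= A n.
  by move=> jM; apply: le_bigmax_seq => //; rewrite mem_index_iota.
pose u n := log2 (A n).
have u0 n : 0 <= u n by apply: log2_ge0.
have a_gt0 n j : (1 <= n)%N -> (1 <= j <= M)%N -> 0 < a n j.
  by move=> n1 jM; apply: lt_le_trans (ha1 n1 jM).
have au n j : (1 <= n)%N -> (1 <= j <= M)%N -> log2 (a n j) <= u n.
  by move=> n1 jM; apply: ler_log2; rewrite ?a_gt0 ?aA.
have d1 : 1 <= d%:R :> R by rewrite ler1n; lia.
have h1 n : 1 <= log_growth gamma d u n.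
  by rewrite log_growth_ge1 ?(ltW g0) // ltnW.
have [N _ HN] := column_ratio ha1 hliminf.
pose C := 1 + \sum_(n < N) u n.
have C1 : 1 <= C by rewrite lerDl sumr_ge0.
exists u; exists C; first by rewrite (le_trans ler01).
split=> // [B N'|n j n1 jM].
  have M1 : (1 <= 1 <= M)%N by lia.
  have [n nN aB] := limn_esup_pinfty_unbounded (hlimsup M1) (2 `^ B) (maxn N' 1).
  exists n; first by lia.
  have n1 : (1 <= n)%N by lia.
  have dn0 : 0 < d%:R ^+ n :> R by rewrite exprn_gt0 // (lt_le_trans ltr01).
  apply: lt_le_trans (au n 1%N n1 M1).
  rewrite ltNge; apply/negP => la.
  have : a n 1%N `^ (d%:R ^+ n)^-1 <= 2 `^ B.
    rewrite -{1}(powR_log2 (a_gt0 n 1%N n1 M1)) -powRrM ler_powR ?ler1n //.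
    by rewrite ler_pdivrMr.
  by rewrite leNgt aB.
rewrite au // andbT.
have [nN|Nn] := ltnP n N.
  apply: le_trans (log2_ge0 (ha1 n1 jM)); rewrite subr_le0.
  apply: le_trans (_ : C * 1 <= _); last by rewrite ler_wpM2l // (le_trans ler01).
  rewrite mulr1 /C (bigD1 (Ordinal nN)) //=.
  have : 0 <= \sum_(i < N | i != Ordinal nN) u i by apply: sumr_ge0.
  lra.
have colle i k : (1 <= i)%N -> (i <= k)%N -> (k <= M)%N -> a n k <= a n i.
  move=> i1; rewrite leq_eqVlt => /orP[/eqP-> //|ik] kM.
  apply: le_trans (HN n Nn i k _ kM); last by rewrite i1.
  by rewrite ler_peMl ?lerDl ?divr_ge0 // ltW // a_gt0 //; lia.
have An : A n = a n 1%N.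
  apply/eqP; rewrite eq_le aA ?andbT; last by lia.
  rewrite /A big_nat; apply: bigmax_le => [|i iM]; first by rewrite ha1.
  by apply: colle; lia.
have MM : (1 <= M <= M)%N by lia.
have aMj : log2 (a n M) <= log2 (a n j).
  by apply: ler_log2; rewrite ?a_gt0 // colle //; lia.
have hu : u n - log_growth gamma d u n <= log2 (a n M).
  have M0 := a_gt0 n M n1 MM; have lM := log2_ge0 (ha1 n1 MM).
  have M1 : (1 <= 1 <= M)%N by lia.
  have := ha_max n1; rewrite lt_max /u An /log_growth => /orP[] /ltW.
    move/(ler_log2 (a_gt0 n 1%N n1 M1)); rewrite log2M ?powR_gt0 // log2_powR.
    have : log2 (a n M) `^ gamma <= log2 (a n 1%N) `^ gamma.
      rewrite ge0_ler_powR ?nnegrE ?(ltW g0) //; first by rewrite log2_ge0 ?ha1.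
      by apply: ler_log2; rewrite // colle //; lia.
    have := powR_ge0 (d%:R : R) (n%:R * gamma).
    rewrite /u An; lra.
  move/(ler_log2 (a_gt0 n 1%N n1 M1)); rewrite log2_powR.
  have := powR_ge0 (log2 (a n 1%N)) gamma; rewrite /u An; lra.
apply: le_trans aMj; apply: le_trans hu; rewrite lerD2l lerN2 ler_peMl //.
exact: le_trans (h1 n).
Qed.
End Size.

(** * Linear forms in quotients of algebraic integers *)

Section AlgInt.
Variable K : fieldExtType rat.
Let intrK : {rmorphism int -> K} := intr.

Lemma algebraic_integerD (x y : K) :
  algebraic_integer x -> algebraic_integer y -> algebraic_integer (x + y).
Proof. exact: (@integral_add _ _ intrK). Qed.

Lemma algebraic_integerM (x y : K) :
  algebraic_integer x -> algebraic_integer y -> algebraic_integer (x * y).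
Proof. exact: (@integral_mul _ _ intrK). Qed.

Lemma algebraic_integer_sum (I : eqType) (r : seq I) (F : I -> K) :
  (forall i, i \in r -> algebraic_integer (F i)) ->
  algebraic_integer (\sum_(i <- r) F i).
Proof.
move=> Fint; rewrite big_seq; apply: (big_ind (@algebraic_integer K)) => //.
  exact: (algebraic_integer_int K 0).
exact: algebraic_integerD.
Qed.

Lemma algebraic_integer_prod (I : eqType) (r : seq I) (F : I -> K) :
  (forall i, i \in r -> algebraic_integer (F i)) ->
  algebraic_integer (\prod_(i <- r) F i).
Proof.
move=> Fint; rewrite big_seq; apply: (big_ind (@algebraic_integer K)) => //.
  exact: (algebraic_integer_int K 1).
exact: algebraic_integerM.
Qed.
End AlgInt.

Lemma normc_sum (R : realType) (I : Type) (r : seq I) (P : pred I)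
    (F : I -> R[i]) :
  normc (\sum_(i <- r | P i) F i) <= \sum_(i <- r | P i) normc (F i).
Proof.
elim/big_rec2: _ => [|i x z _ IH]; first by rewrite normc0.
by apply: le_trans (le_normcD _ _) _; rewrite lerD2l.
Qed.

Lemma normc_gt0 (R : realType) (z : R[i]) : z != 0 -> 0 < normc z.
Proof.
move=> z0; rewrite lt_def normc_ge0 andbT; apply: contra z0 => /eqP.
by move/eq0_normc ->.
Qed.

Lemma normc_int (R : realType) (k : int) : normc (k%:~R : R[i]) = `|k%:~R|.
Proof. by rewrite -normc_real rmorph_int. Qed.

Section ConjugateBound.
Variables (R : realType) (K : fieldExtType rat) (iota : {rmorphism K -> R[i]}).
Local Notation D := (\dim {:K}).

(** [algebraic_integer_norm_ge1] read at the embedding s: no conjugate of a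
    nonzero algebraic integer is small when the others are not large. *)
Lemma normc_embedding_lower (s : {rmorphism K -> R[i]}) (x : K) (G : R) :
  algebraic_integer x -> x != 0 -> 1 <= G -> house iota x <= G ->
  (normc (s x))^-1 <= G ^+ D.-1.
Proof.
move=> xint x0 G1 xG.
have sx0 : 0 < normc (s x) by rewrite normc_gt0 ?fmorph_eq0.
rewrite -[leLHS]mul1r ler_pdivrMr // mulrC.
apply: algebraic_integer_norm_ge1 => // t.
exact: le_trans (normc_embedding_le_house iota t x) xG.
Qed.

(** The integer S, of unknown size, is controlled by solving for it in the real
    equation S b = a e - c, in which b is zero or not too small. The quotient at
    another embedding is then comparable to a. *)
Lemma embedding_quotient_bound (s : {rmorphism K -> R[i]}) (S : int)
    (b c e : K) (G a : R) :
  algebraic_integer b -> algebraic_integer e -> e != 0 ->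
  1 <= G -> house iota b <= G -> house iota c <= G -> house iota e <= G ->
  1 <= a -> iota ((S%:~R * b + c) / e) = a%:C%C ->
  normc (s ((S%:~R * b + c) / e)) <= 3 * a * G ^+ (2 * D).
Proof.
move=> bint eint e0 G1 bG cG eG a1 Da.
have G0 : 0 <= G by rewrite (le_trans ler01).
have a0 : 0 <= a by rewrite (le_trans ler01).
have Dgt0 : (0 < D)%N by apply: adim_gt0.
have GD1 : 1 <= G ^+ D by rewrite exprn_ege1.
have GDS : G * G ^+ D.-1 = G ^+ D by rewrite -exprS prednK.
have G2D : G ^+ (2 * D) = G ^+ D * G ^+ D by rewrite mul2n -addnn exprD.
have nb (t : {rmorphism K -> R[i]}) x : house iota x <= G -> normc (t x) <= G.
  exact: le_trans (normc_embedding_le_house iota t x).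
have Sbound : `|S%:~R| * normc (s b) <= 2 * a * G ^+ D * G.
  have [->|b0] := eqVneq b 0.
    by rewrite rmorph0 normc0 mulr0 !mulr_ge0 ?exprn_ge0.
  have Dib : S%:~R * iota b = a%:C%C * iota e - iota c.
    have : iota (S%:~R * b + c) = a%:C%C * iota e.
      by rewrite -Da -rmorphM divfK.
    by rewrite rmorphD rmorphM rmorph_int => /(canRL (addrK _)).
  have h1 : `|S%:~R| * normc (iota b) <= 2 * a * G.
    rewrite -normc_int -normcM Dib.
    apply: le_trans (le_normcD _ _) _; rewrite normcN normcM normc_real ger0_norm //.
    rewrite -mulrA mulr_natl mulr2n lerD ?ler_wpM2l ?nb //.
    by apply: le_trans (nb _ _ cG) _; rewrite ler_peMl.
  have b_gt0 : 0 < normc (iota b) by rewrite normc_gt0 ?fmorph_eq0.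
  have h2 : `|S%:~R| <= 2 * a * G ^+ D.
    move: h1; rewrite -ler_pdivlMr // => /le_trans; apply.
    rewrite -GDS !mulrA ler_wpM2l ?mulr_ge0 //.
    exact: normc_embedding_lower.
  by apply: ler_pM => //; [apply: normc_ge0 | apply: nb].
rewrite rmorphM fmorphV normcM normcV rmorphD rmorphM rmorph_int.
have num : normc (S%:~R * s b + s c) <= 3 * a * G ^+ D * G.
  apply: le_trans (le_normcD _ _) _; rewrite normcM normc_int.
  have h3 : normc (s c) <= a * G ^+ D * G.
    by apply: le_trans (nb _ _ cG) _; rewrite ler_peMl // mulr_ege1.
  rewrite (_ : 3 * a * G ^+ D * G = 2 * a * G ^+ D * G + a * G ^+ D * G).
    exact: lerD.
  by move: (G ^+ D) => t; ring.
apply: le_trans (ler_pM (normc_ge0 _) _ num (normc_embedding_lower s eint e0 G1 eG)) _.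
  by rewrite invr_ge0 normc_ge0.
by rewrite G2D -(mulrA _ G) GDS mulrA.
Qed.
End ConjugateBound.

Section ScaledContinuants.
Variables (K : fieldExtType rat) (x e : nat -> K) (u v : K).

(** Clearing the denominators e i of the coefficients one factor per step keeps a
    three-term recurrence, with integral coefficients e (n+2) x (n+2) and
    e (n+2) e (n+1). *)
Lemma scaled_three_term_integral :
  (forall n, (1 <= n)%N -> algebraic_integer (e n)) ->
  (forall n, (1 <= n)%N -> algebraic_integer (e n * x n)) ->
  algebraic_integer u -> algebraic_integer v ->
  forall n, algebraic_integer ((\prod_(1 <= i < n.+1) e i) * three_term x u v n.+1).
Proof.
move=> eint exint uint vint.
elim/nat_ind2 => [||n IHn IHn1].
- by rewrite big_geq // mul1r.
- rewrite big_nat1 three_termSS mulrDr mulrA; apply: algebraic_integerD.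
    by apply: algebraic_integerM => //; apply: exint.
  by apply: algebraic_integerM => //; apply: eint.
rewrite three_termSS big_nat_recr //=; set E1 := \prod_(1 <= i < n.+2) e i in IHn1 *.
have -> : E1 * e n.+2 * (x n.+2 * three_term x u v n.+2 + three_term x u v n.+1) =
    (e n.+2 * x n.+2) * (E1 * three_term x u v n.+2) + e n.+2 * e n.+1 *
    ((\prod_(1 <= i < n.+1) e i) * three_term x u v n.+1).
  by rewrite /E1 big_nat_recr //=; ring.
apply: algebraic_integerD; apply: algebraic_integerM => //; first exact: exint.
by apply: algebraic_integerM; apply: eint.
Qed.

Lemma scaled_three_term_bound (R : realType) (s : {rmorphism K -> R[i]})
    (B : nat -> R) :
  (forall n, (1 <= n)%N -> normc (s (e n)) * (normc (s (x n)) + 1) <= B n) ->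
  normc (s u) <= 1 -> normc (s v) <= 1 ->
  forall n, normc (s ((\prod_(1 <= i < n.+1) e i) * three_term x u v n.+1)) <=
    \prod_(1 <= i < n.+1) B i.
Proof.
move=> eB u1 v1 n.
pose P n := \prod_(1 <= i < n.+1) (normc (s (x i)) + 1).
have P1 k : 1 <= P k.
  by apply: (big_ind (fun y => 1 <= y)) => // [y z|i _]; [apply: mulr_ege1 | rewrite lerDr normc_ge0].
have PS k : P k.+1 = P k * (normc (s (x k.+1)) + 1) by rewrite /P big_nat_recr.
have contP : normc (s (three_term x u v n.+1)) <= P n.
  elim/nat_ind2: n => [||n IHn IHn1].
  - exact: le_trans v1 (P1 0%N).
  - rewrite three_termSS rmorphD rmorphM PS /P big_geq // mul1r.
    apply: le_trans (le_normcD _ _) _; rewrite normcM lerD //.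
    by rewrite ler_piMr ?normc_ge0.
  rewrite three_termSS rmorphD rmorphM PS.
  apply: le_trans (le_normcD _ _) _; rewrite normcM mulrDr mulr1 mulrC lerD //.
    by rewrite ler_wpM2r ?normc_ge0.
  by apply: le_trans IHn _; rewrite PS ler_peMr ?lerDr ?normc_ge0 ?(le_trans ler01).
rewrite rmorphM normcM rmorph_prod normc_prod.
apply: le_trans (ler_wpM2l _ contP) _.
  by apply: prodr_ge0 => i _; apply: normc_ge0.
rewrite /P -big_split /= !big_nat; apply: ler_prod => i /andP[i1 _].
by rewrite eB // mulr_ge0 ?addr_ge0 ?normc_ge0.
Qed.
End ScaledContinuants.

(** Multiplying the form by all the Q j gives an algebraic integer, to which
    [algebraic_integer_norm_ge1] applies. At [iota] the factor of the form is kept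
    and the product of the Q j is bounded as at the other embeddings. *)
Lemma linear_form_liouville (R : realType) (K : fieldExtType rat)
    (iota : {rmorphism K -> R[i]}) (M : nat) (l P Q : nat -> K) (B : R) :
  let X := l 0%N + \sum_(1 <= j < M.+1) l j * (P j / Q j) in
  X != 0 -> 1 <= B ->
  (forall j, (j <= M)%N -> algebraic_integer (l j)) ->
  (forall j, (1 <= j <= M)%N -> [/\ Q j != 0, algebraic_integer (P j) &
     algebraic_integer (Q j)]) ->
  (forall (s : {rmorphism K -> R[i]}) j, (1 <= j <= M)%N ->
     normc (s (P j)) <= B /\ normc (s (Q j)) <= B) ->
  1 <= normc (iota X) *
    ((1 + \sum_(0 <= j < M.+1) house iota (l j)) * B ^+ M) ^+ \dim {:K}.
Proof.
move=> X X0 B1 lint PQint PQB.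
(* The factors of the j-th term of the form multiplied by all the Q k. No k in
   the range equals 0, so F 0 k = Q k accounts for the constant term. *)
pose F j k := if k == j then P j else Q k.
pose Y := \sum_(0 <= j < M.+1) l j * \prod_(1 <= k < M.+1) F j k.
have jr j : (j \in index_iota 1 M.+1) = (1 <= j <= M)%N by rewrite mem_index_iota.
have FQ : \prod_(1 <= k < M.+1) F 0%N k = \prod_(1 <= k < M.+1) Q k.
  by rewrite !big_nat; apply: eq_bigr => k /andP[k1 _]; rewrite /F gtn_eqF.
have YX : Y = \prod_(1 <= k < M.+1) Q k * X.
  rewrite /Y [LHS]big_ltn // FQ /X mulrDr mulrC; congr (_ + _).
  rewrite mulr_sumr; apply: eq_big_nat => j jM.
  have [Qj0 _ _] := PQint j jM.
  rewrite mulrCA; congr (_ * _).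
  rewrite (bigD1_seq j) ?jr ?iota_uniq //= [in RHS](bigD1_seq j) ?jr ?iota_uniq //=.
  rewrite [F j j]/F eqxx [Q j * _]mulrC -mulrA (mulrCA (Q j)) divff // mulr1 mulrC.
  by congr (_ * _); apply: eq_bigr => k /negPf; rewrite /F => ->.
have Fj j k : (1 <= k <= M)%N -> (F j k = P k) + (F j k = Q k).
  by rewrite /F; case: eqP => [->|]; [left | right].
have Qprod0 : \prod_(1 <= k < M.+1) Q k != 0.
  rewrite prodf_seq_neq0; apply/allP => k; rewrite jr => /PQint[Q0 _ _].
  by rewrite Q0.
have Yint : algebraic_integer Y.
  apply: algebraic_integer_sum => j; rewrite mem_index_iota => jM.
  apply: algebraic_integerM; first exact: lint.
  apply: algebraic_integer_prod => k; rewrite jr => kM.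
  by case: (Fj j k kM) => ->; have [_ ? ?] := PQint k kM.
have Y0 : Y != 0 by rewrite YX mulf_neq0.
have prodB (G : nat -> R[i]) : (forall k, (1 <= k <= M)%N -> normc (G k) <= B) ->
    normc (\prod_(1 <= k < M.+1) G k) <= B ^+ M.
  move=> GB; rewrite normc_prod -[X in _ <= _ ^+ X](subn1 M.+1) -prodr_const_nat.
  rewrite !big_nat; apply: ler_prod => k kM.
  by rewrite normc_ge0 GB.
set L := 1 + _.
have house_ge0 x : 0 <= house iota x by apply: bigmax_ge_id.
have L1 : 1 <= L by rewrite lerDl sumr_ge0.
have LB : B ^+ M <= L * B ^+ M.
  by rewrite ler_peMl // exprn_ge0 // (le_trans ler01).
have BM1 : 1 <= B ^+ M by rewrite exprn_ege1.
have YB (s : {rmorphism K -> R[i]}) : normc (s Y) <= L * B ^+ M.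
  rewrite rmorph_sum; apply: le_trans (normc_sum _ _ _) _.
  apply: le_trans (_ : (\sum_(0 <= j < M.+1) house iota (l j)) * B ^+ M <= _).
    rewrite mulr_suml !big_nat; apply: ler_sum => j jM.
    rewrite rmorphM normcM rmorph_prod ler_pM ?normc_ge0 //.
      exact: normc_embedding_le_house.
    apply: prodB => k kM; have [? ?] := PQB s k kM.
    by case: (Fj j k kM) => ->.
  by rewrite ler_wpM2r ?(le_trans ler01) // lerDr.
have := algebraic_integer_norm_ge1 iota Yint Y0 (le_trans BM1 LB) YB.
move/le_trans; apply.
have Dgt0 : (0 < \dim {:K})%N by apply: adim_gt0.
rewrite -[in leRHS](prednK Dgt0) exprS mulrA.
rewrite ler_wpM2r ?exprn_ge0 ?(le_trans _ (le_trans BM1 LB)) //.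
rewrite YX rmorphM normcM mulrC ler_wpM2l ?normc_ge0 //.
apply: le_trans LB; rewrite rmorph_prod; apply: prodB => k kM.
by have [] := PQB iota k kM.
Qed.

(** Let J be the last index with z J nonzero. If the sum vanished, the term of
    index J, at least |z J| g n J / 2 in modulus, would be at most the sum of the
    terms of index j < J, which are arbitrarily small compared with g n J. *)
Lemma dominant_term_nonzero (R : realType) (M : nat) (z : nat -> R[i])
    (err g : nat -> nat -> R) :
  (forall n j, (1 <= j <= M)%N -> g n j / 2 <= `|err n j| <= g n j) ->
  (forall n j, (1 <= j <= M)%N -> 0 < g n j) ->
  (forall B j k, (1 <= j < k)%N -> (k <= M)%N ->
     \forall n \near \oo, B * g n j <= g n k) ->
  (exists2 j, (1 <= j <= M)%N & z j != 0) ->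
  \forall n \near \oo, \sum_(1 <= j < M.+1) z j * (err n j)%:C%C != 0.
Proof.
move=> errg g0 dom [j0 j0M zj0].
pose P j := (1 <= j <= M)%N && (z j != 0).
have exP : exists j, P j by exists j0; rewrite /P j0M.
have ubP j : P j -> (j <= M)%N by case/andP => /andP[].
case: (ex_maxnP exP ubP) => J /andP[JM zJ] maxJ {j0 j0M zj0 exP}.
pose Z := \sum_(1 <= j < M.+1) normc (z j).
have Z0 : 0 <= Z by apply: sumr_ge0 => j _; apply: normc_ge0.
have zJ0 := normc_gt0 zJ.
(* Any B with B * normc (z J) > 2 * Z gives the contradiction. *)
pose B := (2 * Z + 1) / normc (z J).
have : \forall n \near \oo, forall j : 'I_J, (0 < j)%N -> B * g n j <= g n J.
  apply: filter_forall => j; case: (posnP j) => [->|j1]; first exact: nearW.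
  have jJ : (1 <= j < J)%N by rewrite j1 ltn_ord.
  by apply: filterS (dom B j J jJ (ubP _ _)) => //; rewrite /P JM.
apply: filterS => n domn; apply/negP => /eqP sum0.
have g_J := g0 n J JM.
have B0 : 0 < B by rewrite divr_gt0 // ltr_wpDl // mulr_ge0.
have key : B * (normc (z J) * (g n J / 2)) <= Z * g n J.
  have memJ : J \in index_iota 1 M.+1 by rewrite mem_index_iota.
  move: sum0; rewrite (bigD1_seq J) ?iota_uniq //= => /eqP.
  rewrite addr_eq0 => /eqP zerrJ.
  have : normc (z J) * (g n J / 2) <= \sum_(1 <= j < M.+1 | j != J) normc (z j) * `|err n j|.
    apply: le_trans (_ : normc (z J) * `|err n J| <= _).
      by rewrite ler_wpM2l ?normc_ge0 //; case/andP: (errg n J JM).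
    rewrite -normc_real -normcM zerrJ normcN.
    apply: le_trans (normc_sum _ _ _) _; apply: ler_sum => j _.
    by rewrite normcM normc_real.
  move/(ler_wpM2l (ltW B0))/le_trans; apply.
  rewrite mulr_sumr /Z mulr_suml.
  rewrite [leRHS](bigD1_seq J) ?iota_uniq //= -[leLHS]add0r lerD //.
    by rewrite mulr_ge0 ?normc_ge0 // ltW.
  rewrite big_seq_cond [leRHS]big_seq_cond; apply: ler_sum => j /andP[].
  rewrite mem_index_iota => jM jJ.
  have [->|zj] := eqVneq (z j) 0; first by rewrite normc0 !mul0r mulr0.
  have jltJ : (j < J)%N by rewrite ltn_neqAle jJ maxJ // /P jM.
  rewrite mulrCA ler_wpM2l ?normc_ge0 //.
  have j1 : (0 < j)%N by case/andP: jM.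
  apply: le_trans (domn (Ordinal jltJ) j1); rewrite ler_wpM2l ?(ltW B0) //.
  by case/andP: (errg n j jM).
have : B * normc (z J) <= 2 * Z.
  rewrite -(ler_pM2r g_J); lra.
rewrite /B divfK ?gt_eqF //; lra.
Qed.

Lemma algebraic_integer_common_denominator (K : fieldExtType rat)
    (l : nat -> K) (M : nat) :
  exists2 m : int, m != 0 &
    forall j, (j <= M)%N -> algebraic_integer (m%:~R * l j).
Proof.
elim: M => [|M [m m0 IHM]].
  have [m m0 lm] := algebraic_integer_clear_denominator (l 0%N).
  by exists m => // j; rewrite leqn0 => /eqP ->.
have [k k0 lk] := algebraic_integer_clear_denominator (l M.+1).
exists (k * m); first by rewrite mulf_neq0.
move=> j; rewrite leq_eqVlt intrM => /orP[/eqP ->|jM].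
  rewrite mulrAC mulrC; apply: algebraic_integerM lk.
  exact: algebraic_integer_int.
rewrite -mulrA; apply: algebraic_integerM (IHM j jM).
exact: algebraic_integer_int.
Qed.

(** * Linear forms in the tails of the continued fractions *)

Lemma prod_powR (R : realType) (x : R) (I : Type) (r : seq I) (f : I -> R) :
  0 < x -> \prod_(i <- r) x `^ f i = x `^ (\sum_(i <- r) f i).
Proof.
move=> x0; elim/big_rec2: _ => [|i y z _ ->]; first by rewrite powRr0.
by rewrite powRD //; apply/implyP => _; rewrite gt_eqF.
Qed.

Lemma powR_ge1_exponent_ge0 (R : realType) (E : R) : 1 <= 2 `^ E -> 0 <= E.
Proof.
by move/(ler_log2 ltr01); rewrite log2_powR /log2 ln1 mul0r.
Qed.

Section Core.
Variables (R : realType) (M d : nat) (gamma : R).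
Hypotheses (hgamma : 0 < gamma < 1) (hd2 : (2 <= d)%N).
Variables (K : fieldExtType rat) (iota : {rmorphism K -> R[i]}).
Local Notation D := (\dim {:K}).
Hypothesis (hdD : (D * M - 1 <= d)%N).
Variables (S : nat -> nat -> int) (b c e : nat -> nat -> K).
Variables (aK : nat -> nat -> K) (a : nat -> nat -> R).
Hypotheses
    (hb : forall n j, (1 <= n)%N -> (1 <= j <= M)%N -> algebraic_integer (b n j))
    (hc : forall n j, (1 <= n)%N -> (1 <= j <= M)%N -> algebraic_integer (c n j))
    (he : forall n j, (1 <= n)%N -> (1 <= j <= M)%N -> algebraic_integer (e n j))
    (he0 : forall n j, (1 <= n)%N -> (1 <= j <= M)%N -> e n j != 0)
    (haK : forall n j, (1 <= n)%N -> (1 <= j <= M)%N ->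
       aK n j = ((S n j)%:~R * b n j + c n j) / e n j)
    (ha : forall n j, (1 <= n)%N -> (1 <= j <= M)%N ->
       iota (aK n j) = ((a n j)%:C)%C)
    (ha1 : forall n j, (1 <= n)%N -> (1 <= j <= M)%N -> 1 <= a n j)
    (hb_house : forall n j, (1 <= n)%N -> (1 <= j <= M)%N ->
       house iota (b n j) <= growth_bound gamma d n (a n j))
    (hc_house : forall n j, (1 <= n)%N -> (1 <= j <= M)%N ->
       house iota (c n j) <= growth_bound gamma d n (a n j))
    (he_house : forall n j, (1 <= n)%N -> (1 <= j <= M)%N ->
       house iota (e n j) <= growth_bound gamma d n (a n j)).
Variables (u : nat -> R) (C : R).
Hypotheses (C0 : 0 <= C) (u0 : forall n, 0 <= u n).
Hypothesis u_unb : forall B N, exists2 n, (N <= n)%N & B * d%:R ^+ n < u n.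
Local Notation h := (log_growth gamma d u).
Hypothesis ua : forall n j, (1 <= n)%N -> (1 <= j <= M)%N ->
        u n - C * h n <= log2 (a n j) <= u n.
Hypothesis col_ratio : \forall n \near \oo,
  forall j k, (1 <= j < k)%N -> (k <= M)%N -> (1 + 8 / n%:R) * a n k <= a n j.

Let a_gt0 n j : (1 <= n)%N -> (1 <= j <= M)%N -> 0 < a n j.
Proof. by move=> n1 jM; apply: lt_le_trans (ha1 n1 jM). Qed.

Let h_ge1 n : 1 <= h n.
Proof.
by have /andP[g0 _] := hgamma; rewrite log_growth_ge1 ?(ltW g0) // ltnW.
Qed.

Lemma growth_bound_le n j : (1 <= n)%N -> (1 <= j <= M)%N ->
  growth_bound gamma d n (a n j) <= 2 `^ h n.
Proof.
move=> n1 jM; have /andP[g0 _] := hgamma.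
have /andP[_ au] := ua n1 jM.
have la0 := log2_ge0 (ha1 n1 jM).
rewrite /growth_bound ge_max !ler_powR ?ler1n // /log_growth.
  by rewrite lerDr powR_ge0.
by apply: (@le_trans _ _ (u n `^ gamma));
  rewrite ?lerDl ?powR_ge0 // ge0_ler_powR ?nnegrE ?(ltW g0).
Qed.

(** With G = 2^(h n) the left side is at most G (3 a G^(2 D) + 1), hence at most
    4 a G^(2 D + 1), and 4 <= G^2 because h n >= 1. *)
Lemma embedding_term_bound (s : {rmorphism K -> R[i]}) n j :
  (1 <= n)%N -> (1 <= j <= M)%N ->
  normc (s (e n j)) * (normc (s (aK n j)) + 1) <=
    2 `^ (u n + (2 * D + 3)%:R * h n).
Proof.
move=> n1 jM; have h1 := h_ge1 n.
have GB := growth_bound_le n1 jM; set G := 2 `^ h n in GB.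
have G1 : 1 <= G.
  by rewrite -(powRr0 2) ler_powR ?ler1n // (le_trans ler01).
have G0 : 0 <= G by rewrite (le_trans ler01).
have eB : normc (s (e n j)) <= G.
  apply: le_trans (normc_embedding_le_house iota s _) _.
  exact: le_trans (he_house n1 jM) GB.
have xB : normc (s (aK n j)) <= 3 * a n j * G ^+ (2 * D).
  rewrite haK //; apply: (embedding_quotient_bound (iota := iota)); auto.
  - exact: le_trans (hb_house n1 jM) GB.
  - exact: le_trans (hc_house n1 jM) GB.
  - exact: le_trans (he_house n1 jM) GB.
  - by rewrite -haK // ha.
have aG1 : 1 <= a n j * G ^+ (2 * D) by rewrite mulr_ege1 ?ha1 ?exprn_ege1.
have xB1 : normc (s (aK n j)) + 1 <= 4 * (a n j * G ^+ (2 * D)).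
  by move: xB aG1; rewrite -mulrA; move: (a n j * _) => t; lra.
apply: le_trans (ler_pM (normc_ge0 _) _ eB xB1) _.
  by rewrite addr_ge0 ?normc_ge0.
have -> : u n + (2 * D + 3)%:R * h n =
    h n + ((h n + h n) + (u n + h n * (2 * D)%:R)).
  by rewrite natrD; move: ((2 * D)%:R : R) => t; ring.
have powD x y : 2 `^ (x + y) = 2 `^ x * 2 `^ y :> R.
  by rewrite powRD //; apply/implyP => _; rewrite pnatr_eq0.
rewrite powD -/G ler_wpM2l // powD; apply: ler_pM => //.
- by rewrite mulr_ge0 ?exprn_ge0 // ltW // a_gt0.
- rewrite powD -/G; apply: le_trans (_ : 2 * 2 <= _); first by rewrite -natrM.
  have G2 : 2 <= G by rewrite -[leLHS]powRr1 // ler_powR ?ler1n.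
  exact: ler_pM.
rewrite powD powRrM powR_mulrn // ler_wpM2r ?exprn_ge0 //.
rewrite -[leLHS](powR_log2 (a_gt0 n1 jM)) ler_powR ?ler1n //.
by case/andP: (ua n1 jM).
Qed.

Let q n j := three_term (a^~ j) 0 1 n.
Let g n j := (q n.+1 j * q n.+2 j)^-1.
Let U n := \sum_(1 <= i < n.+1) u i.
Let H n := \sum_(1 <= i < n.+1) h i.

Let colge1 j (jM : (1 <= j <= M)%N) : forall n, (1 <= n)%N -> 1 <= a n j :=
  fun n n1 => ha1 n1 jM.

Lemma denominator_growth n j : (1 <= j <= M)%N -> 2 `^ (U n - C * H n) <= q n.+1 j.
Proof.
move=> jM.
have -> : U n - C * H n = \sum_(1 <= i < n.+1) (u i - C * h i).
  by rewrite /U /H mulr_sumr -sumrB.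
rewrite -prod_powR //.
elim: n => [|n IHn]; first by rewrite big_geq.
rewrite big_nat_recr //= mulrC.
apply: le_trans (denominator_mul_le (colge1 jM) n).
apply: ler_pM => //.
  by apply: prodr_ge0 => i _; apply: powR_ge0.
have n1 : (1 <= n.+1)%N by [].
rewrite -[leRHS](powR_log2 (a_gt0 n1 jM)) ler_powR ?ler1n //.
by case/andP: (ua n1 jM).
Qed.

(** The gap g n j is, up to a factor 2, the error of the n-th convergent of the
    j-th continued fraction. *)
Lemma gap_growth n j : (1 <= j <= M)%N ->
  g n j <= 2 `^ (- (2 * U n + u n.+1 - 2 * C * H n.+1)).
Proof.
move=> jM; rewrite powRN /g lef_pV2 ?posrE ?powR_gt0 //; last first.
  by rewrite mulr_gt0 // denominator_gt0 //; apply: colge1.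
apply: le_trans (ler_pM (powR_ge0 _ _) (powR_ge0 _ _)
  (denominator_growth n jM) (denominator_growth n.+1 jM)).
rewrite -powRD; last by apply/implyP => _; rewrite pnatr_eq0.
have HS : H n.+1 = H n + h n.+1 by rewrite /H big_nat_recr.
have US : U n.+1 = U n + u n.+1 by rewrite /U big_nat_recr.
rewrite ler_powR ?ler1n // US.
have : 0 <= C * (H n.+1 - H n).
  by rewrite mulr_ge0 // HS addrAC subrr add0r (le_trans ler01) ?h_ge1.
lra.
Qed.

Let t n j := three_term (a^~ j) 1 0 n.+1 / q n.+1 j.
Let T j := limn (t^~ j).

(** The core of the argument, for the tails T j of the continued fractions and
    integral coefficients. The form X n is nonzero for large n, and combining
    [linear_form_liouville] with [gap_growth] contradicts [growth_excess]. *)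
Lemma linear_form_trivial (l : nat -> K) :
  (forall j, (j <= M)%N -> algebraic_integer (l j)) ->
  iota (l 0%N) + \sum_(1 <= j < M.+1) iota (l j) * (T j)%:C%C = 0 ->
  forall j, (1 <= j <= M)%N -> l j = 0.
Proof.
move=> lint rel j0 j0M; apply/eqP/negPn/negP => lj0.
pose err n j := T j - t n j.
have q_gt0 n j : (1 <= j <= M)%N -> 0 < q n.+1 j.
  by move=> jM; apply: denominator_gt0 => // ?; apply: colge1.
have g_gt0 n j : (1 <= j <= M)%N -> 0 < g n j.
  by move=> jM; rewrite invr_gt0 mulr_gt0 ?q_gt0.
have errg n j : (1 <= j <= M)%N -> g n j / 2 <= `|err n j| <= g n j.
  move=> jM.
  have /andP[h1 h2] : g n j / 2 <= (-1) ^+ n * (T j - t n j) <= g n j.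
    exact: convergent_error_bounds (colge1 jM) n.
  have errE : `|err n j| = (-1) ^+ n * (T j - t n j).
    rewrite -(ger0_norm (le_trans _ h1)); last by rewrite divr_ge0 ?ltW ?g_gt0.
    by rewrite normrM normr_sign mul1r.
  by rewrite errE h1 h2.
have dom B j k : (1 <= j < k)%N -> (k <= M)%N ->
    \forall n \near \oo, B * g n j <= g n k.
  move=> jk kM; have jM : (1 <= j <= M)%N by lia.
  have kM' : (1 <= k <= M)%N by lia.
  have [N _ HN] := col_ratio.
  have HN' n : (N <= n)%N -> (1 + 8 / n%:R) * a n k <= a n j.
    by move=> Nn; apply: HN.
  have [N1 _ HN1] := denominator_ratio_large (colge1 jM) (colge1 kM') (Num.max B 1) HN'.
  exists N1 => // n /= N1n.
  pose B' := Num.max B 1; have B1 : 1 <= B' by rewrite le_max lexx orbT.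
  have r1 : B' * q n.+1 k <= q n.+1 j by apply: HN1; rewrite /=; lia.
  have r2 : B' * q n.+2 k <= q n.+2 j by apply: HN1; rewrite /=; lia.
  apply: (@le_trans _ _ (B' * g n j)).
    by rewrite ler_wpM2r ?(ltW (g_gt0 _ _ _)) // le_max lexx.
  rewrite /g -ler_pdivlMr ?invr_gt0 ?mulr_gt0 ?q_gt0 // invrK.
  rewrite mulrC ler_pdivlMr ?mulr_gt0 ?q_gt0 //.
  rewrite mulrA ler_pM ?q_gt0 ?mulr_ge0 ?(ltW (q_gt0 _ _ _)) ?(le_trans ler01) //.
  apply: le_trans r2; rewrite ler_peMl // ltW // q_gt0 //.
have lnz : exists2 j, (1 <= j <= M)%N & iota (l j) != 0.
  by exists j0; rewrite ?fmorph_eq0.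
have [N _ HN] := dominant_term_nonzero errg g_gt0 dom lnz.
pose X n := l 0%N + \sum_(1 <= j < M.+1)
  l j * (three_term (aK^~ j) 1 0 n.+1 / three_term (aK^~ j) 0 1 n.+1).
have contK (v v' : K) (w w' : R) n j : (1 <= j <= M)%N ->
    iota v = w%:C%C -> iota v' = w'%:C%C ->
    iota (three_term (aK^~ j) v v' n) = (three_term (a^~ j) w w' n)%:C%C.
  move=> jM vw vw'.
  have xa k : (1 <= k)%N -> iota (aK k j) = (a k j)%:C%C by move=> k1; apply: ha.
  rewrite (@rmorph_three_term _ _ iota _ (fun k => (a k j)%:C%C)) // vw vw'.
  by rewrite (@rmorph_three_term _ _ (real_complex R) (a^~ j) (fun k => (a k j)%:C%C)).
have iota0 : iota 0 = (0 : R)%:C%C by rewrite rmorph0.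
have iota1 : iota 1 = (1 : R)%:C%C by rewrite rmorph1.
have denK0 n j : (1 <= j <= M)%N -> three_term (aK^~ j) 0 1 n.+1 != 0.
  move=> jM; rewrite -(fmorph_eq0 iota) (contK _ _ 0 1) // fmorph_eq0.
  by rewrite gt_eqF ?q_gt0.
have XE n : iota (X n) = - \sum_(1 <= j < M.+1) iota (l j) * (err n j)%:C%C.
  rewrite /X rmorphD rmorph_sum.
  have -> : iota (l 0%N) = - \sum_(1 <= j < M.+1) iota (l j) * (T j)%:C%C.
    by apply/eqP; rewrite -addr_eq0 rel.
  rewrite -!sumrN -big_split; apply: eq_big_nat => j jM /=.
  rewrite rmorphM fmorph_div (contK _ _ 1 0) // (contK _ _ 0 1) // -fmorph_div.
  by rewrite -[_ / _]/(t n j) /err rmorphB mulrBr opprB addrC.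
pose L := 1 + \sum_(0 <= j < M.+1) house iota (l j).
have house_ge0 x : 0 <= house iota x by apply: bigmax_ge_id.
have L1 : 1 <= L by rewrite lerDl sumr_ge0.
have L0 : 0 < L by apply: lt_le_trans L1.
pose lam := log2 L.
have lam0 : 0 <= lam by apply: log2_ge0.
have LE : L = 2 `^ lam by rewrite powR_log2.
(* The error terms come from the coefficients of the form, from the bounds on
   the conjugates and from the lower bounds on the denominators. *)
pose C' : R := D.+1%:R * lam + (D * M)%:R * (2 * D + 3)%:R + 2 * C.
have C'0 : 0 <= C'.
  by rewrite /C'; apply: addr_ge0; [apply: addr_ge0 |]; apply: mulr_ge0.
have [n Nn] := growth_excess hgamma hd2 C'0 u0 u_unb N.
rewrite -[\sum_(1 <= i < n.+1) u i]/(U n) -[\sum_(1 <= i < n.+2) _]/(H n.+1).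
apply/negP; rewrite -leNgt.
have X0 : X n != 0 by rewrite -(fmorph_eq0 iota) XE oppr_eq0; apply: HN.
pose E j := \prod_(1 <= i < n.+1) e i j.
have E0 j : (1 <= j <= M)%N -> E j != 0.
  move=> jM; rewrite prodf_seq_neq0; apply/allP => i.
  by rewrite mem_index_iota => /andP[i1 _]; rewrite he0.
pose P j := E j * three_term (aK^~ j) 1 0 n.+1.
pose Q j := E j * three_term (aK^~ j) 0 1 n.+1.
have XPQ : X n = l 0%N + \sum_(1 <= j < M.+1) l j * (P j / Q j).
  congr (_ + _); apply: eq_big_nat => j jM; congr (_ * _).
  by rewrite /P /Q -mulf_div divff ?mul1r ?E0.
pose beta := U n + (2 * D + 3)%:R * H n.
have betaE : \prod_(1 <= i < n.+1) 2 `^ (u i + (2 * D + 3)%:R * h i) = 2 `^ beta.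
  by rewrite prod_powR // big_split -mulr_sumr.
have H0 m : 0 <= H m.
  by apply: sumr_ge0 => i _; apply: le_trans (h_ge1 i).
have U0 m : 0 <= U m by apply: sumr_ge0.
have beta0 : 0 <= beta by rewrite addr_ge0 ?mulr_ge0.
have B1 : 1 <= 2 `^ beta :> R by rewrite -[leLHS](powRr0 2) ler_powR ?ler1n.
have int0 := algebraic_integer_int K 0; have int1 := algebraic_integer_int K 1.
have exint j : (1 <= j <= M)%N -> forall i, (1 <= i)%N ->
    algebraic_integer (e i j * aK i j).
  move=> jM i i1; rewrite haK // mulrC divfK ?he0 //.
  apply: algebraic_integerD; last exact: hc.
  by apply: algebraic_integerM; [apply: algebraic_integer_int | apply: hb].
have PQint j : (1 <= j <= M)%N ->
    [/\ Q j != 0, algebraic_integer (P j) & algebraic_integer (Q j)].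
  move=> jM; split; first by rewrite mulf_neq0 ?E0 ?denK0.
    by apply: scaled_three_term_integral => // [i i1|]; [apply: he | apply: exint].
  by apply: scaled_three_term_integral => // [i i1|]; [apply: he | apply: exint].
have PQB (s : {rmorphism K -> R[i]}) j : (1 <= j <= M)%N ->
    normc (s (P j)) <= 2 `^ beta /\ normc (s (Q j)) <= 2 `^ beta.
  move=> jM; rewrite -betaE.
  have eB i : (1 <= i)%N -> normc (s (e i j)) * (normc (s (aK i j)) + 1) <=
      2 `^ (u i + (2 * D + 3)%:R * h i) by move=> i1; apply: embedding_term_bound.
  by split; apply: scaled_three_term_bound => //;
    rewrite ?rmorph0 ?rmorph1 ?normc0 ?normc1.
have := @linear_form_liouville R K iota M l P Q (2 `^ beta).
rewrite -XPQ -/L => /(_ X0 B1 lint PQint PQB) main.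
pose W := 2 * U n + u n.+1 - 2 * C * H n.+1.
have XB : normc (iota (X n)) <= L * 2 `^ (- W).
  rewrite XE normcN; apply: le_trans (normc_sum _ _ _) _.
  apply: le_trans (_ : (\sum_(1 <= j < M.+1) house iota (l j)) * 2 `^ (- W) <= _).
    rewrite mulr_suml !big_nat; apply: ler_sum => j jM.
    rewrite normcM normc_real ler_pM ?normc_ge0 ?normc_embedding_le_house //.
    have /andP[_ /le_trans] := errg n j jM; apply.
    exact: gap_growth.
  rewrite ler_wpM2r ?powR_ge0 // /L [in leRHS]big_ltn //.
  by rewrite addrA lerDr addr_ge0.
have Lb0 : 0 <= L * 2 `^ beta ^+ M by rewrite mulr_ge0 ?exprn_ge0 ?powR_ge0 ?(ltW L0).
have {main}main : 1 <= 2 `^ (lam - W + (lam + beta * M%:R) * D%:R).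
  apply: le_trans main _; apply: le_trans (ler_wpM2r _ XB) _.
    by rewrite exprn_ge0.
  have two x y : 2 `^ (x + y) = 2 `^ x * 2 `^ y :> R.
    by rewrite powRD //; apply/implyP => _; rewrite pnatr_eq0.
  rewrite LE -!powR_mulrn ?mulr_ge0 ?powR_ge0 // -powRrM.
  by rewrite -two -two -powRrM -two.
move/powR_ge1_exponent_ge0: main.
have HS : H n.+1 = H n + h n.+1 by rewrite /H big_nat_recr.
have H1 : 1 <= H n.+1.
  by rewrite HS -[leLHS]add0r lerD ?h_ge1.
have HH : H n <= H n.+1.
  by rewrite HS lerDl (le_trans ler01) ?h_ge1.
have DMd : (D * M)%:R <= d%:R + 1 :> R by rewrite natr1 ler_nat -add1n -leq_subLR.
have := U0 n; rewrite /W /beta /C' -[D.+1%:R]natr1 natrM in DMd *.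
move: (D%:R : R) (M%:R : R) ((2 * D + 3)%:R : R) (ler0n R D) (ler0n R M)
  (ler0n R (2 * D + 3)) DMd => Dr Mr k D0 M0 k0 DMd Un0 main.
(* The estimates D M - 1 <= d, 1 <= H n.+1 and H n <= H n.+1 in the multiplied
   form that makes the conclusion linear. *)
have p1 : 0 <= (d%:R + 1 - Dr * Mr) * U n by rewrite mulr_ge0 // subr_ge0.
have p2 : 0 <= (Dr + 1) * lam * (H n.+1 - 1).
  by apply: mulr_ge0; [apply: mulr_ge0 => //; apply: addr_ge0 | rewrite subr_ge0].
have p3 : 0 <= Dr * Mr * k * (H n.+1 - H n)
    by apply: mulr_ge0; [do 2!apply: mulr_ge0 => // | rewrite subr_ge0].
move: main p1 p2 p3; move: (U n) (H n) (H n.+1) (u n.+1) (d%:R : R).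
move=> Un Hn Hn1 un dr main p1 p2 p3.
lra.
Qed.
End Core.

Theorem theorem2 (R : realType) (D M d : nat) (gamma : R)
    (hD : (0 < D)%N) (hM : (0 < M)%N)
    (hgamma : 0 < gamma < 1)
    (hd : d = maxn 2 (D * M - 1))
    (K : fieldExtType rat) (iota : {rmorphism K -> R[i]})
    (hK : \dim {:K} = D)
    (S : nat -> nat -> int) (b c e : nat -> nat -> K)
    (aK : nat -> nat -> K) (a : nat -> nat -> R) (alpha : nat -> R[i])
    (hb : forall n j, (1 <= n)%N -> (1 <= j <= M)%N -> algebraic_integer (b n j))
    (hc : forall n j, (1 <= n)%N -> (1 <= j <= M)%N -> algebraic_integer (c n j))
    (he : forall n j, (1 <= n)%N -> (1 <= j <= M)%N -> algebraic_integer (e n j))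
    (he0 : forall n j, (1 <= n)%N -> (1 <= j <= M)%N -> e n j != 0)
    (haK : forall n j, (1 <= n)%N -> (1 <= j <= M)%N ->
       aK n j = ((S n j)%:~R * b n j + c n j) / e n j)
    (ha : forall n j, (1 <= n)%N -> (1 <= j <= M)%N ->
       iota (aK n j) = ((a n j)%:C)%C)
    (ha1 : forall n j, (1 <= n)%N -> (1 <= j <= M)%N -> 1 <= a n j)
    (halpha : forall j, (1 <= j <= M)%N ->
       alpha j = continued_fraction (fun n => iota (aK n j)))
    (ha_max : forall n, (1 <= n)%N ->
       a n 1%N < Num.max (a n M * 2 `^ (log2 (a n M) `^ gamma))
                         (2 `^ (d%:R `^ (n%:R * gamma))))
    (hb_house : forall n j, (1 <= n)%N -> (1 <= j <= M)%N ->
       house iota (b n j) <= growth_bound gamma d n (a n j))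
    (hc_house : forall n j, (1 <= n)%N -> (1 <= j <= M)%N ->
       house iota (c n j) <= growth_bound gamma d n (a n j))
    (he_house : forall n j, (1 <= n)%N -> (1 <= j <= M)%N ->
       house iota (e n j) <= growth_bound gamma d n (a n j))
    (hliminf : forall j, (1 <= j < M)%N ->
       (0 < limn_einf (fun n =>
          (Num.sqrt n%:R * (a n j / a n j.+1 - 1))%:E))%E)
    (hlimsup : forall j, (1 <= j <= M)%N ->
       limn_esup (fun n => (a n j `^ (d%:R ^+ n)^-1)%:E) = +oo%E)
    (hcond :
       (forall n j, (1 <= n)%N -> (1 <= j <= M)%N ->
          forall z, z \in conjugates iota (aK n j)^-1 ->
            ComplexField.Normc.normc z <= 1 / 2)
       \/
       (forall j, (1 <= j <= M)%N -> forall sigma : {rmorphism K -> R[i]},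
          exists eps : bool, forall n, (1 <= n)%N ->
            (growth_bound gamma d n (a n 1%N))^-1
              <= (-1) ^+ eps * complex.Re (sigma (aK n j)))) :
  forall l : nat -> K,
    iota (l 0%N) + \sum_(1 <= j < M.+1) iota (l j) * alpha j = 0 ->
    forall j, (j <= M)%N -> l j = 0.
Proof.
move=> l rel.
have d2 : (2 <= d)%N by rewrite hd leq_max.
have DMd : (\dim {:K} * M - 1 <= d)%N by rewrite hK hd leq_max leqnn orbT.
have [u [C C0 [u0 u_unb ua]]] :=
  log_size hM hgamma d2 ha1 hliminf ha_max hlimsup.
have ratio := column_ratio ha1 hliminf.
pose T j := limn (fun n => three_term (a^~ j) 1 0 n.+1 / three_term (a^~ j) 0 1 n.+1).
have alphaE j : (1 <= j <= M)%N -> alpha j = iota (aK 0%N j) + (T j)%:C%C.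
  move=> jM; rewrite halpha //.
  by apply: continued_fraction_real_tail => n n1; [apply: ha | apply: ha1].
(* The initial partial quotients are absorbed into the constant coefficient. *)
pose l' j := if j is 0 then l 0%N + \sum_(1 <= j < M.+1) l j * aK 0%N j else l j.
have [m m0 l'int] := algebraic_integer_common_denominator l' M.
have rel' : iota (m%:~R * l' 0%N) +
    \sum_(1 <= j < M.+1) iota (m%:~R * l' j) * (T j)%:C%C = 0.
  have -> : \sum_(1 <= j < M.+1) iota (m%:~R * l' j) * (T j)%:C%C =
      iota m%:~R * \sum_(1 <= j < M.+1) iota (l j) * (T j)%:C%C.
    rewrite mulr_sumr; apply: eq_big_nat => j /andP[j1 _].
    by rewrite rmorphM mulrA /l'; case: j j1.
  rewrite rmorphM -mulrDr; apply/eqP; rewrite mulf_eq0; apply/orP; right.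
  apply/eqP; apply: etrans rel; rewrite /l' rmorphD rmorph_sum -addrA -big_split.
  congr (_ + _); apply: eq_big_nat => j jM /=.
  by rewrite alphaE // rmorphM mulrDr.
have l0 j : (1 <= j <= M)%N -> l j = 0.
  move=> jM; have := linear_form_trivial hgamma d2 DMd hb hc he he0 haK ha
    ha1 hb_house hc_house he_house C0 u0 u_unb ua ratio l'int rel' jM.
  move/eqP; rewrite mulf_eq0 -(fmorph_eq0 iota) rmorph_int intr_eq0 (negPf m0).
  by case: j jM => // j _ /eqP.
case=> [_|j jM]; last exact: l0.
move: rel; rewrite big_nat big1 => [/eqP|j jM]; last by rewrite l0 ?rmorph0 ?mul0r.
by rewrite addr0 fmorph_eq0 => /eqP.
Qed.
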